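(* Let $X_{n,j}$ be the number of trees of size $j$ in the decomposition of the functional graph of a uniformly random mapping $f:\{1,\dots,n\}\to\{1,\dots,n\}$, and let $\lambda_{n,j}=\frac{j^{j-1}\sqrt{n}}{j!\,e^{j}}$. Then for $n\to\infty$ and $1\le j=j(n)\le n$ with $j=o(n)$, for every $s\ge1$, \[ \mathbb{E}\big(X_{n,j}^{\underline{s}}\big)=\lambda_{n,j}^s\,2^{s/2}\,\Gamma\big(\tfrac{s}{2}+1\big)(1+o(1)). \] Let $X$ be Rayleigh distributed with parameter $1$. Then: (i) if $\lambda_{n,j}\to\infty$, $X_{n,j}/\lambda_{n,j}$ converges in distribution, with convergence of all moments, to $X$; (ii) if $\lambda_{n,j}\to\rho\in(0,\infty)$, $X_{n,j}$ converges in distribution, with convergence of all moments, to $Y\sim\mathrm{MPo}(\rho X)$. Moreover, $Y/\rho$ converges in distribution to $X$ as $\rho\to\infty$, with convergence of all moments.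
   Context: A random $n$-mapping is chosen uniformly among the $n^n$ functions $f:\{1,\dots,n\}\to\{1,\dots,n\}$. A point $c$ is cyclic if $f^{\ell}(c)=c$ for some $\ell\ge1$. The functional graph decomposes into cycles of rooted trees: for each cyclic point $c$, its tree consists of all $x$ such that $c$ is the first cyclic point in the sequence $x,f(x),f^2(x),\dots$; its size is the number of such $x$. The Rayleigh distribution with parameter $1$ has density $xe^{-x^2/2}$, $x\ge0$. $x^{\underline{s}}=x(x-1)\cdots(x-s+1)$. For non-negative $X$ and $\rho>0$, $Y\sim\mathrm{MPo}(\rho X)$ means $\mathbb{P}\{Y=\ell\}=\frac{\rho^\ell}{\ell!}\mathbb{E}(X^\ell e^{-\rho X})$. ''Convergence of all moments'' refers to non-negative integer moments. *)

(* Defs.v *)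
From HB Require Import structures.
From mathcomp Require Import all_boot all_order all_algebra.
From mathcomp Require Import all_classical all_reals all_analysis.
Set Implicit Arguments. Unset Strict Implicit. Unset Printing Implicit Defensive.
Import Order.TTheory GRing.Theory Num.Theory.
Import numFieldNormedType.Exports.
Local Open Scope classical_set_scope.
Local Open Scope ring_scope.

Definition mapping (n : nat) := {ffun 'I_n -> 'I_n}.

Definition cyclic n (f : mapping n) (c : 'I_n) : Prop :=
  exists l : nat, (0 < l)%N /\ iter l f c = c.

Definition in_tree n (f : mapping n) (c x : 'I_n) : Prop :=
  exists k : nat, iter k f x = c /\ cyclic f c /\
                  (forall i : nat, (i < k)%N -> ~ cyclic f (iter i f x)).

Definition tree_size n (f : mapping n) (c : 'I_n) : nat :=
  #|[set x : 'I_n | `[< in_tree f c x >]]|.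

Definition Xnj n (j : nat) (f : mapping n) : nat :=
  #|[set c : 'I_n | `[< cyclic f c /\ tree_size f c = j >]]|.

Definition Emap {R : realType} n (g : mapping n -> R) : R :=
  (#|{: mapping n}|%:R)^-1 * \sum_(f : mapping n) g f.

Definition lambda {R : realType} (n j : nat) : R :=
  (j%:R ^+ j.-1 * Num.sqrt (n%:R)) / ((j`!)%:R * expR (j%:R)).

Definition Gamma {R : realType} (x : R) : R :=
  \int[lebesgue_measure]_(t in [set t : R | 0 < t]) (t `^ (x - 1) * expR (- t)).

Definition rayleigh_density {R : realType} (x : R) : R := x * expR (- (x ^+ 2) / 2).

Definition rayleigh_expect {R : realType} (g : R -> R) : R :=
  \int[lebesgue_measure]_(x in [set x : R | 0 <= x]) (g x * rayleigh_density x).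

Definition rayleigh_cdf {R : realType} (a : R) : R :=
  rayleigh_expect (fun x => if x <= a then 1 else 0).

Definition mpo_pmf {R : realType} (rho : R) (l : nat) : R :=
  rho ^+ l / (l`!)%:R * rayleigh_expect (fun x => x ^+ l * expR (- (rho * x))).

Definition mpo_expect {R : realType} (rho : R) (g : nat -> R) : R :=
  limn (series (fun l => g l * mpo_pmf rho l)).

Definition cvg_distr {R : realType} (Fn : nat -> R -> R) (F : R -> R) : Prop :=
  forall x : R, {for x, continuous F} -> (fun n => Fn n x) @ \oo --> F x.

(* Main.v *)
(* Replacing the permutation of the cyclic points of a mapping by the identity leaves a
   rooted forest and loses a factor (number of roots)!.  Peeling off one tree of size j
   after another, and counting forests by their levels, gives with N = n - sj

     E X^_s = n! N^N / (N! n^n) (j^(j-1) / j!)^s A_s(N),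

   where A_s(N) = E (C + 1) ... (C + s) for the number C of cyclic points of a random
   N-mapping.  A telescoping sum yields A_(s+2) = (s + 2) (N A_s + A_(s+1)), and
   Cauchy-Schwarz yields A_(s+1)^2 <= A_s A_(s+2).  The Rayleigh moments satisfy the limiting
   relations mu_(s+2) = (s + 2) mu_s and mu_(s+1)^2 <= mu_s mu_(s+2), and, as in Wallis'
   product, these determine mu_1; hence A_s(N) ~ N^(s/2) mu_s.  Since n! e^n / n^n is
   nondecreasing and n! e^n / n^(n+1) is nonincreasing, no Stirling formula is needed.

   Moments of X follow from factorial moments through Stirling numbers.  Convergence of
   moments gives convergence of Laplace transforms (alternating Taylor bounds), hence of
   all polynomials in exp(-x), and Bernstein polynomials squeeze the distribution
   function. *)
Require Import Defs.
From HB Require Import structures.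
From mathcomp Require Import all_boot all_order all_algebra all_fingroup.
From mathcomp Require Import zify ring lra.
Set Implicit Arguments. Unset Strict Implicit. Unset Printing Implicit Defensive.

(** * Gluing maps, forests and the cyclic core *)

Section Glue.
Variable T : finType.
Implicit Types (S K U V L : {set T}) (h g f : {ffun T -> T}).

(** The rising product (C + 1) ... (C + s) arises because removing s trees also removes s roots: the
    weight of a forest is the factorial of its number of roots, and it becomes (m + s)! when m roots
    remain.

    In the limit the recurrence for the moments links indices of equal parity only, so the even
    moments start from 1 while the first moment has no initial value. Log-convexity ties the two
    parities together, and this is what fixes it.

    The three kinds of law (a finite average, an integral, a series) are treated alike, as positive
    normalised linear functionals on functions of at most exponential growth. This growth class also
    makes the moments determine the limit: a finite mean of exp(2 t x) forces t^K E X^K / K! to be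
    small for some K. Limits are taken along an arbitrary proper filter, so that the same statements
    serve n to infinity and rho to infinity. *)

Definition idffun : {ffun T -> T} := [ffun x => x].
Definition glue S h1 h2 : {ffun T -> T} := [ffun x => if x \in S then h1 x else h2 x].
(** Parts of a map stay total maps on [T], with the identity as default outside the part. In
    particular the roots of a forest become fixed points. *)
Definition restr S h := glue S h idffun.

Lemma restr_glue S h1 h2 : restr S (glue S h1 h2) = restr S h1.
Proof. by apply/ffunP=> x; rewrite !ffunE; case: (x \in S). Qed.

Lemma restrC_glue S h1 h2 : restr (~: S) (glue S h1 h2) = restr (~: S) h2.
Proof. by apply/ffunP=> x; rewrite !ffunE inE; case: (x \in S). Qed.

Lemma glue_restr S h : glue S (restr S h) (restr (~: S) h) = h.
Proof. by apply/ffunP=> x; rewrite !ffunE inE; case: (x \in S). Qed.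

(** A map is the same as a pair of independent restrictions, so a condition that splits over [S] and
    its complement gives a double sum. The two hypotheses say that the maps counted on each side are
    already in restricted form. *)
Lemma sum_glue S (A B : pred {ffun T -> T}) (G : {ffun T -> T} -> nat) :
  (forall h, A h -> restr S h = h) -> (forall h, B h -> restr (~: S) h = h) ->
  \sum_(h | A (restr S h) && B (restr (~: S) h)) G h =
  \sum_(h1 | A h1) \sum_(h2 | B h2) G (glue S h1 h2).
Proof.
move=> hA hB.
rewrite pair_big_dep /=.
rewrite (reindex_onto (fun h => (restr S h, restr (~: S) h)) (fun p => glue S p.1 p.2)) /=.
  apply: eq_big => [h|h _]; last by rewrite glue_restr.
  by rewrite glue_restr eqxx andbT.
case=> h1 h2 /= /andP[/hA e1 /hB e2].
by rewrite restr_glue restrC_glue e1 e2.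
Qed.

Lemma iter_restr S h x i : {in S, forall y, h y \in S} -> x \in S ->
  iter i (restr S h) x = iter i h x /\ iter i h x \in S.
Proof.
move=> hS xS; elim: i => [//|i [IH1 IH2]] /=.
by rewrite IH1; split; [rewrite ffunE IH2 | exact: hS].
Qed.

Lemma iter_fix h x i : h x = x -> iter i h x = x.
Proof. by move=> hx; elim: i => //= i ->. Qed.

Lemma fconnectP h x y : reflect (exists i, iter i h x = y) (fconnect h x y).
Proof.
apply: (iffP idP) => [/iter_findex <-|[i <-]]; first by eexists.
exact: fconnect_iter.
Qed.

(* The maps that fix the points outside [U] and send every point of [U] eventually
   into [K]: for disjoint [K] and [U], the forests on [K :|: U] with root set [K]. *)
Definition forest K U h :=
  [forall x, if x \in U then [exists k in K, fconnect h x k] else h x == x].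

Lemma forestP K U h : reflect
  ({in ~: U, forall x, h x = x} /\ {in U, forall x, exists i, iter i h x \in K})
  (forest K U h).
Proof.
apply: (iffP forallP) => [H|[H1 H2] x].
  split=> x; rewrite ?inE; have := H x; case: ifPn => // _.
    by move=> /eqP.
  by move=> /existsP[k /andP[kK /fconnectP[i ik]]] _; exists i; rewrite ik.
case: ifPn => xU; last by apply/eqP/H1; rewrite inE.
by have [i ik] := H2 _ xU; apply/existsP; exists (iter i h x); rewrite ik fconnect_iter.
Qed.


(** A point outside both sets is fixed and not a root, so an orbit entering it would never reach
    [K]. *)
Lemma forest_stable K U h x : [disjoint K & U] -> forest K U h ->
  x \in U -> h x \in K :|: U.
Proof.
move=> dKU /forestP[H1 H2] xU; apply/negPn/negP; rewrite !inE negb_or => /andP[hK hU].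
have hx : h (h x) = h x by apply: H1; rewrite inE.
have [[|i]] := H2 _ xU; first by rewrite /= (disjointFl dKU xU).
by rewrite iterSr iter_fix // (negPf hK).
Qed.

(** Up to the first visit to [K] the two orbits coincide. *)
Lemma reach_congr K h h' x i : {in ~: K, forall y, h y = h' y} ->
  iter i h x \in K -> exists i', iter i' h' x \in K.
Proof.
move=> hh'; elim: i x => [|i IH] x; first by exists 0.
case: (boolP (x \in K)) => xK; first by exists 0.
rewrite iterSr => /IH[i' Hi']; exists i'.+1.
by rewrite iterSr -hh' // inE.
Qed.

Definition level K U h := [set x in U | h x \in K].

Definition maps_into L K : pred {ffun T -> T} :=
  family (fun x => if x \in L then mem K else mem (pred1 x)).

Lemma maps_intoP L K h : reflect
  ({in L, forall x, h x \in K} /\ {in ~: L, forall x, h x = x}) (maps_into L K h).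
Proof.
apply: (iffP familyP) => [H|[H1 H2] x].
  split=> x; rewrite ?inE => xL; have := H x; first by rewrite xL.
  by rewrite (negPf xL) inE => /eqP.
by case: ifPn => xL; [exact: H1 | rewrite inE; apply/eqP/H2; rewrite inE].
Qed.

Lemma card_maps_into L K : \sum_(h | maps_into L K h) 1 = #|K| ^ #|L|.
Proof.
rewrite sum1_card card_family foldrE big_map big_enum /=.
rewrite (bigID (mem L)) /= [X in _ * X]big1 ?muln1.
  rewrite -[RHS]prod_nat_const; apply: eq_bigr => x; rewrite unfold_in => /= xL.
  by rewrite xL; apply: eq_card.
by move=> x /negPf ->; rewrite card1.
Qed.

(** The points at distance one from the roots map freely into [K] and serve as the roots of what
    remains. Conversely, a point of [U :\: L] is mapped into [U], which is disjoint from [K], so the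
    first level is no larger than [L]. *)
Lemma forest_peel_level K U L h : [disjoint K & U] -> L \subset U ->
  (forest K U h && (level K U h == L)) =
  (maps_into L K (restr L h) && forest L (U :\: L) (restr (~: L) h)).
Proof.
move=> dKU sLU.
have agree : {in ~: L, forall y, h y = restr (~: L) h y}.
  by move=> y yL; rewrite ffunE yL.
apply/andP/andP => [[fh /eqP lev]|[/maps_intoP[A1 A2] fh']].
  have [F1 F2] := forestP _ _ _ fh.
  have hL x : x \in L -> h x \in K by rewrite -lev inE => /andP[].
  split.
    apply/maps_intoP; split => x; rewrite ?inE => xL; rewrite !ffunE.
      by rewrite xL hL.
    by rewrite (negPf xL).
  apply/forestP; split => x.
    rewrite !inE ffunE inE negb_and negbK; case: (boolP (x \in L)) => //= xL xU.
      by rewrite ffunE.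
    by apply: F1; rewrite inE.
  rewrite inE => /andP[xL xU]; have [i ik] := F2 _ xU.
  suff [i' Hi'] : exists i', iter i' h x \in L by apply: reach_congr agree Hi'.
  elim: i x xU ik {xL} => [|i IH] x xU; first by rewrite /= (disjointFl dKU xU).
  rewrite iterSr => ik.
  case: (boolP (x \in L)) => xL; first by exists 0.
  have hxK : h x \notin K by move: xL; rewrite -lev inE xU.
  have hxU : h x \in U by have := forest_stable dKU fh xU; rewrite inE (negPf hxK).
  by have [i' Hi'] := IH _ hxU ik; exists i'.+1; rewrite iterSr.
have [F1 F2] := forestP _ _ _ fh'.
have hL x : x \in L -> h x \in K by move=> xL; have := A1 _ xL; rewrite ffunE xL.
have dL : [disjoint L & U :\: L].
  by rewrite -setI_eq0; apply/eqP/setP=> x; rewrite !inE; case: (x \in L).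
split.
  apply/forestP; split => x.
    rewrite inE => xU; have xL : x \notin L by apply: contra xU => /(subsetP sLU).
    by rewrite agree ?inE //; apply: F1; rewrite !inE xL xU.
  move=> xU.
  have [i Hi] : exists i, iter i h x \in L.
    case: (boolP (x \in L)) => xL; first by exists 0.
    have [|i ik] := F2 x; first by rewrite inE xL.
    by apply: reach_congr ik => y yL; rewrite agree.
  by exists i.+1; rewrite iterS hL.
apply/eqP/setP => x; rewrite inE; apply/andP/idP => [[xU hxK]|xL].
  apply/negPn/negP => xL.
  have : restr (~: L) h x \in L :|: (U :\: L).
    by apply: forest_stable fh' _; rewrite // inE xL.
  rewrite -agree ?inE // => /orP[/(subsetP sLU)|/andP[_]] hU;
  by rewrite (disjointFr dKU hxK) in hU.
by split; [exact: (subsetP sLU) | exact: hL].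
Qed.

Lemma sum_subsets (U : {set T}) (F : nat -> nat) :
  \sum_(L : {set T} | L \subset U) F #|L| = \sum_(l < #|U|.+1) 'C(#|U|, l) * F l.
Proof.
rewrite (partition_big (fun L : {set T} => inord #|L| : 'I_#|U|.+1) xpredT) //=.
apply: eq_bigr => l _; rewrite -cards_draws -sum1dep_card big_distrl /=.
have inE' (L : {set T}) : L \subset U -> (inord #|L| : 'I_#|U|.+1) = #|L| :> nat.
  by move=> /subset_leq_card sLU; rewrite inordK.
apply: eq_big => [L|L].
  by case: (boolP (L \subset U)) => //= /inE' e; rewrite -val_eqE /= e.
by move=> /andP[/inE' e /eqP <-]; rewrite e mul1n.
Qed.

(** Cayley's formula m (m + u)^(u - 1) for forests on m + u points with m given roots. The case u =
    0 is set apart: its value is 1, even for m = 0. *)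
Definition forest_count m u := if u is u'.+1 then m * (m + u) ^ u' else 1.

(** With l the size of the first level, the term l = 0 vanishes, and l C(u + 1, l) = (u + 1) C(u, l
    - 1) turns the rest into the binomial expansion of m (m + u + 1)^u. *)
Lemma forest_count_rec m u :
  \sum_(l < u.+2) 'C(u.+1, l) * (m ^ l * forest_count l (u.+1 - l)) =
  forest_count m u.+1.
Proof.
rewrite big_ord_recl /= muln0 add0n /bump /=.
have -> : forall u, m * (m + u.+1) ^ u = \sum_(i < u.+1) 'C(u, i) * (m ^ i.+1 * u.+1 ^ (u - i)).
  move=> v; rewrite addnC expnDn big_distrr /=; apply: eq_bigr => i _.
  by rewrite expnS mulnCA (mulnC (_ ^ (_ - _))) !mulnA.
apply: eq_bigr => i _; rewrite /bump /= add1n subSS.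
case: (ltngtP i u) => [iu|iu|iu]; last 1 first.
- by rewrite iu subnn /= !binn.
- rewrite -(subnSK iu) /= (_ : i.+1 + _ = u.+1); last by lia.
  rewrite (expnS u.+1 (u - i.+1)); transitivity ((i.+1 * 'C(u.+1, i.+1)) * (m ^ i.+1 * u.+1 ^ (u - i.+1))).
    by lia.
  by rewrite -mul_bin_diag /=; lia.
- by have := ltn_ord i; rewrite ltnS leqNgt iu.
Qed.

Lemma card_forest K U : [disjoint K & U] ->
  \sum_(h | forest K U h) 1 = forest_count #|K| #|U|.
Proof.
have [n] := ubnP #|U|; elim: n K U => // n IH K U; rewrite ltnS => le dKU.
case: (posnP #|U|) => [/eqP|U0].
  rewrite cards_eq0 => /eqP ->; rewrite cards0 /=.
  rewrite (big_pred1 idffun) // => h; apply/forestP/eqP => [[H _]|->].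
    by apply/ffunP => x; rewrite ffunE H // !inE.
  by split=> x; rewrite ?ffunE // inE.
rewrite (partition_big (level K U) (fun L => L \subset U)) /=; last first.
  by move=> h _; apply/subsetP => x; rewrite inE => /andP[].
transitivity (\sum_(L : {set T} | L \subset U) #|K| ^ #|L| * forest_count #|L| (#|U| - #|L|)).
  apply: eq_bigr => L sLU.
  under eq_bigl => h do rewrite forest_peel_level //.
  rewrite sum_glue; first last.
  - move=> h /forestP[H _]; apply/ffunP => x; rewrite ffunE inE.
    by case: ifPn; rewrite // ffunE negbK => xL; rewrite H // !inE xL.
  - move=> h /maps_intoP[_ H]; apply/ffunP => x; rewrite ffunE.
    by case: ifPn; rewrite // ffunE => xL; rewrite H // inE.
  rewrite -card_maps_into big_distrl /=; apply: eq_bigr => h1 _; rewrite mul1n.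
  (* An empty first level leaves [U] as large as before, so the induction hypothesis does not apply;
     but then no point of the non-empty [U] can reach a root, and [forest_count 0] is 0 there as
     well. *)
  case: (posnP #|L|) => [/eqP|L0].
    rewrite cards_eq0 => /eqP ->; rewrite cards0 setD0 subn0.
    rewrite big_pred0; first by case: #|U| U0 => //= u _.
    move=> h; apply/negP => /forestP[_ H].
    move: U0 => /card_gt0P[x /H[i]]; by rewrite inE.
  have cU : #|U :\: L| = #|U| - #|L| by rewrite cardsD (setIidPr sLU).
  rewrite IH ?cU //.
    by rewrite (leq_trans _ le) // ltn_subrL L0 U0.
  by rewrite -setI_eq0; apply/eqP/setP=> x; rewrite !inE; case: (x \in L).
rewrite (sum_subsets U (fun l => #|K| ^ l * forest_count l (#|U| - l))).
by case: #|U| U0 => // u _; rewrite forest_count_rec.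
Qed.

(** Connection is tested from [f x], since [fconnect f x x] holds for every point. *)
Definition core f := [set x | fconnect f (f x) x].

Lemma coreP f x : reflect (exists i, iter i.+1 f x = x) (x \in core f).
Proof.
rewrite inE; apply: (iffP (fconnectP _ _ _)) => -[i e]; exists i; move: e;
by rewrite iterSr.
Qed.

Lemma core_stable f x : x \in core f -> f x \in core f.
Proof. by move=> /coreP[i e]; apply/coreP; exists i; rewrite -iterSr iterS e. Qed.

(** Both points are fixed by the iterate whose order is the product of their periods; this order is
    positive, so the iterate factors through the common image. *)
Lemma core_inj f : {in core f &, injective f}.
Proof.
move=> x y /coreP[i ex] /coreP[j ey] exy.
have per k z n : iter k.+1 f z = z -> iter (n * k.+1) f z = z.
  by move=> e; elim: n => // n IH; rewrite mulSn iterD IH e.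
have ex' := per _ _ j.+1 ex; have ey' := per _ _ i.+1 ey.
rewrite -ex' -ey' [j.+1 * _]mulnC -[i.+1 * _]prednK ?muln_gt0 //.
by rewrite !iterSr exy.
Qed.

(** Pigeonhole: an orbit has at most #|T| distinct points, so it returns to an earlier one, which is
    then periodic. *)
Lemma reach_core f x : exists i, iter i f x \in core f.
Proof.
have /trajectP[i ltin e] : looping f x #|T|.+1.
  by apply: contraT; rewrite -looping_uniq => /card_uniqP; rewrite size_traject => h;
     have := max_card [in traject f x #|T|.+2]; rewrite h ltnNge leqnSn.
exists i; apply/coreP; exists (#|T| - i).
by rewrite -iterD addSn subnK // -ltnS.
Qed.

Definition perms_on K : pred {ffun T -> T} :=
  fun s => [exists p : {perm T}, perm_on K p && (s == pval p)].

Lemma card_perms_on K : \sum_(s | perms_on K s) 1 = #|K|`!.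
Proof.
rewrite -card_perm -(card_imset _ val_inj) sum1_card; apply: eq_card => s.
rewrite unfold_in; apply/existsP/imsetP => [[p /andP[pK /eqP ->]]|[p pK ->]]; exists p => //.
by rewrite eqxx andbT.
Qed.

Lemma core_decomp K f : (core f == K) =
  perms_on K (restr K f) && forest K (~: K) (restr (~: K) f).
Proof.
apply/eqP/andP => [<-|[/existsP[p /andP[pK /eqP ep]] /forestP[F1 F2]]].
  set C := core f; split.
    have inj : injectiveb (restr C f).
      apply/injectiveP => x y; rewrite !ffunE.
      case: ifPn => xC; case: ifPn => yC; rewrite ?ffunE // => e.
      - exact: core_inj e.
      - by rewrite -e core_stable in yC.
      - by rewrite e core_stable in xC.
    apply/existsP; exists (Perm inj); rewrite eqxx andbT.
    apply/subsetP => x; rewrite !inE; apply: contraR => xC.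
    by rewrite unlock /= ffunE /C inE (negPf xC) ffunE.
  apply/forestP; split=> x; first by rewrite setCK => xC; rewrite ffunE in_setC xC ffunE.
  move=> _; have [i ic] := reach_core f x.
  by apply: reach_congr ic => y yC; rewrite ffunE yC.
have pE x : p x = restr K f x by rewrite ep -pvalE.
have fK x : x \in K -> f x \in K.
  by move=> xK; have := perm_closed x pK; rewrite xK pE ffunE xK.
have fKi i x : x \in K -> iter i f x \in K by move=> xK; elim: i => //= i; apply: fK.
apply/setP => x; apply/idP/idP => [/coreP[i e]|xK].
  have [k kK] : exists k, iter k f x \in K.
    case: (boolP (x \in K)) => xK; first by exists 0.
    have [|k kK] := F2 x; first by rewrite inE.
    by apply: reach_congr kK => y yK; rewrite ffunE yK.
  have per n : iter (n * i.+1) f x = x.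
    by elim: n => // n IH; rewrite mulSn iterD IH e.
  (* After k steps the orbit of [x] is in [K], and it stays there for the k i further steps that
     complete k periods and bring it back to [x]. *)
  rewrite -(per k) mulnS addnC iterD; exact: fKi.
rewrite inE; have : fconnect p (p x) x by rewrite (fconnect_sym perm_inj) fconnect1.
move=> /iter_findex; set i := findex _ _ _ => e; apply/fconnectP; exists i.
have [|<- _] := @iter_restr K f (f x) i _ (fK _ xK); first by move=> y; apply: fK.
have -> : f x = p x by rewrite pE ffunE xK.
by rewrite -[RHS]e; apply: eq_iter => y; rewrite pE.
Qed.

(** The summand does not see how the core is permuted, so every forest rooted at [K] counts once for
    each of the #|K|! permutations. *)
Lemma sum_core_decomp (G : {set T} -> {ffun T -> T} -> nat) :
  \sum_f G (core f) (restr (~: core f) f) =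
  \sum_(K : {set T}) #|K|`! * \sum_(h | forest K (~: K) h) G K h.
Proof.
rewrite (partition_big core xpredT) //=; apply: eq_bigr => K _.
transitivity (\sum_(f | core f == K) G K (restr (~: K) f)).
  by apply: eq_bigr => f /eqP ->.
under eq_bigl => h do rewrite core_decomp.
rewrite sum_glue; first last.
- move=> h /forestP[H _]; apply/ffunP => x; rewrite ffunE inE.
  by case: ifPn; rewrite // ffunE negbK => xL; rewrite H // !inE xL.
- move=> h /existsP[p /andP[pK /eqP ->]]; apply/ffunP => x; rewrite ffunE.
  by case: ifPn; rewrite // ffunE pvalE => xK; rewrite (out_perm pK).
rewrite -card_perms_on big_distrl /=; apply: eq_bigr => h1 _; rewrite mul1n.
apply: eq_bigr => h fh; rewrite restrC_glue.
have /forestP[H _] := fh; congr G; apply/ffunP => x; rewrite ffunE inE.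
by case: ifPn; rewrite // ffunE negbK => xL; rewrite H // !inE xL.
Qed.

End Glue.

(** * Peeling off trees *)

Section Trees.
Variable T : finType.
Implicit Types (S K U V L : {set T}) (h g f : {ffun T -> T}).

Definition tree h c := [set x | fconnect h x c].

Definition nb_trees j K h := #|[set c in K | #|tree h c| == j]|.

Lemma tree_root h c : c \in tree h c.
Proof. by rewrite inE connect0. Qed.

Lemma tree_step h c x : h c = c -> (h x \in tree h c) = (x \in tree h c).
Proof.
move=> hc; rewrite !inE; apply/fconnectP/fconnectP => -[i e].
  by exists i.+1; rewrite iterSr.
case: i e => [/= ->|i]; first by exists 0.
by rewrite iterSr => e; exists i.
Qed.

Lemma forest_fix K U h c : forest K U h -> c \notin U -> h c = c.
Proof. by move=> /forestP[H _] cU; apply: H; rewrite inE. Qed.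

Lemma fix_reach h x y : h x = x -> fconnect h x y -> x = y.
Proof. by move=> hx /fconnectP[i <-]; rewrite iter_fix. Qed.

(** One step of the map neither enters nor leaves the tree of a fixed root, so [S] and its
    complement are both stable and the condition splits. The last conjunct keeps the other roots out
    of [S], because the roots of distinct trees are distinct fixed points. *)
Lemma forest_peel_tree V K S c h : K \subset V -> c \in K -> S \subset V ->
  c \in S ->
  (forest K (V :\: K) h && (tree h c == S)) =
  [&& forest [set c] (S :\ c) (restr S h),
      forest (K :\ c) ((V :\: S) :\: (K :\ c)) (restr (~: S) h) &
      K :\ c \subset V :\: S].
Proof.
move=> sKV cK sSV cS.
apply/andP/and3P => [[fh /eqP tS]|[f1 f2 sKVS]].
  have hc : h c = c by apply: forest_fix fh _; rewrite inE cK.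
  have stS : {in S, forall y, h y \in S} by move=> y; rewrite -tS tree_step.
  have stC : {in ~: S, forall y, h y \in ~: S}.
    by move=> y; rewrite !in_setC -tS tree_step.
  have KS k : k \in K -> k \in S -> k = c.
    move=> kK; rewrite -tS inE; apply: fix_reach.
    by apply: forest_fix fh _; rewrite inE kK.
  split.
  - apply/forestP; split => x.
      rewrite !inE negb_and negbK => /orP[/eqP ->|xS]; rewrite ffunE ?cS //.
      by rewrite (negPf xS) ffunE.
    rewrite !inE => /andP[xc xS].
    have : x \in tree h c by rewrite tS.
    rewrite inE => /fconnectP[i e]; exists i.
    by have [-> _] := iter_restr i stS xS; rewrite e inE.
  - have [F1 F2] := forestP _ _ _ fh.
    apply/forestP; split => x.
      rewrite in_setC in_setD ffunE; case: ifPn; rewrite ?ffunE // in_setC => xS xU.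
      apply: F1; move: xU; rewrite !inE xS /=; apply: contra => /andP[/negPf -> ->].
      by rewrite andbF.
    rewrite !in_setD => /andP[xK /andP[xS xV]].
    have xC : x \in ~: S by rewrite in_setC.
    have [|i ik] := F2 x.
      rewrite inE xV andbT; move: xK; rewrite in_set1 negb_and negbK.
      by case/orP => // /eqP xc; rewrite xc cS in xS.
    exists i; have [-> iC] := iter_restr i stC xC.
    rewrite in_setD1 ik andbT; apply: contraTneq iC => ->.
    by rewrite in_setC cS.
  - apply/subsetP => k; rewrite !inE => /andP[kc kK]; rewrite (subsetP sKV) // andbT.
    by apply: contra kc => kS; rewrite (KS k).
have d1 : [disjoint [set c] & S :\ c].
  by rewrite disjoints1 !inE eqxx.
have d2 : [disjoint K :\ c & (V :\: S) :\: (K :\ c)].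
  by rewrite -setI_eq0; apply/eqP/setP=> x; rewrite !inE; case: eqP; case: (x \in K).
have KS k : k \in K -> k \in S -> k = c.
  move=> kK kS; apply/eqP; apply: contraTT kS => kc.
  by have := subsetP sKVS k; rewrite !inE kc kK => /(_ isT)/andP[].
have hc : h c = c.
  by have := forest_fix f1 (c := c); rewrite !inE eqxx ffunE cS => /(_ isT).
have stS : {in S, forall y, h y \in S}.
  move=> y yS; case: (eqVneq y c) => [->|yc]; first by rewrite hc.
  have := forest_stable d1 f1 (x := y); rewrite !inE yc yS ffunE yS => /(_ isT).
  by case/orP => [/eqP ->|/andP[]].
have stC : {in ~: S, forall y, h y \in ~: S}.
  move=> y yS; case: (boolP (y \in (V :\: S) :\: (K :\ c))) => yU.
    have := forest_stable d2 f2 yU; rewrite ffunE yS in_setU => /orP[|].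
      by move=> /(subsetP sKVS); rewrite !inE => /andP[].
    by rewrite !inE => /andP[_ /andP[]].
  by have := forest_fix f2 yU; rewrite ffunE yS => ->.
split.
  apply/forestP; split => x; rewrite !inE.
    rewrite negb_and negbK => xKV; case: (boolP (x \in S)) => xS.
      case/orP: xKV => [xK|]; first by rewrite (KS x) ?hc.
      by rewrite (subsetP sSV).
    have := forest_fix f2 (c := x); rewrite ffunE !inE xS; apply.
    case/orP: xKV => [xK|/negPf ->]; last by rewrite !andbF.
    have -> : x != c by apply/eqP => xc; rewrite xc cS in xS.
    by rewrite xK.
  move=> /andP[xK xV]; case: (boolP (x \in S)) => xS.
    have [_ /(_ x)] := forestP _ _ _ f1; rewrite !inE xS andbT => H.
    have [|i] := H; first by apply: contraNneq xK => ->.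
    have [-> _] := iter_restr i stS xS; rewrite inE => /eqP e.
    by exists i; rewrite e.
  have xC : x \in ~: S by rewrite in_setC.
  have [_ /(_ x)] := forestP _ _ _ f2; rewrite !inE xS (negPf xK) xV andbF => /(_ isT)[i].
  have [-> _] := iter_restr i stC xC; rewrite inE => /andP[_ iK].
  by exists i.
apply/eqP/setP => x; rewrite inE; apply/fconnectP/idP => [[i e]|xS].
  apply: contraLR cS => xS; rewrite -in_setC -e.
  have xC : x \in ~: S by rewrite in_setC.
  by have [_] := iter_restr i stC xC.
case: (eqVneq x c) => [->|xc]; first by exists 0.
have [_ /(_ x)] := forestP _ _ _ f1; rewrite !inE xS xc => /(_ isT)[i].
have [-> _] := iter_restr i stS xS; rewrite inE => /eqP e.
by exists i.
Qed.

Lemma nb_trees_peel j V K S c h : K \subset V -> c \in K -> S \subset V ->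
  c \in S -> #|S| = j ->
  forest K (V :\: K) h -> tree h c = S ->
  nb_trees j K h = (nb_trees j (K :\ c) (restr (~: S) h)).+1.
Proof.
move=> sKV cK sSV cS Sj fh tS.
have hc : h c = c by apply: forest_fix fh _; rewrite inE cK.
have stC : {in ~: S, forall y, h y \in ~: S}.
  by move=> y; rewrite !in_setC -tS tree_step.
rewrite /nb_trees (cardsD1 c) inE cK tS Sj eqxx add1n; congr _.+1.
apply: eq_card => k; rewrite !inE -!andbA; apply: andb_id2l => kc.
apply: andb_id2l => kK; congr (_ == _); apply: eq_card => x; rewrite !inE.
have kS : k \notin S.
  rewrite -tS inE; apply: contra kc => /fix_reach -> //.
  by apply: forest_fix fh _; rewrite inE kK.
case: (boolP (x \in S)) => xS; last first.
  apply/fconnectP/fconnectP => -[i e]; exists i; move: e;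
  by have [|-> _] := iter_restr (x := x) i stC; rewrite ?in_setC.
have stS : {in S, forall y, h y \in S} by move=> y; rewrite -tS tree_step.
transitivity false; [|symmetry]; apply/negP.
  move=> /fconnectP[i e]; have [_] := iter_restr i stS xS.
  by rewrite e (negPf kS).
move=> /fix_reach e; move: kS; rewrite -e ?xS //.
by rewrite ffunE in_setC xS ffunE.
Qed.

Definition tree_sum j V (w : nat -> nat) s :=
  \sum_(K : {set T} | K \subset V)
     \sum_(h | forest K (V :\: K) h) w #|K| * (nb_trees j K h) ^_ s.

Lemma forest_idC K U h S : forest K U h -> S \subset ~: U -> restr (~: S) h = h.
Proof.
move=> fh sSU; apply/ffunP => x; rewrite ffunE in_setC.
case: ifPn => //; rewrite negbK => xS; rewrite ffunE (forest_fix fh) //.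
by have := subsetP sSU x xS; rewrite in_setC.
Qed.

Lemma forest_id K U h S : forest K U h -> U \subset S -> restr S h = h.
Proof.
move=> fh sSU; apply/ffunP => x; rewrite ffunE.
case: ifPn => // xS; rewrite ffunE (forest_fix fh) //.
by apply: contra xS; apply: (subsetP sSU).
Qed.

(** Each of the j roots carries j^(j - 2) trees by Cayley's formula. *)
Lemma card_rooted_trees S : #|S| > 0 ->
  \sum_(c in S) \sum_(h | forest [set c] (S :\ c) h) 1 = #|S| ^ #|S|.-1.
Proof.
move=> S0.
transitivity (\sum_(c in S) forest_count 1 #|S|.-1).
  apply: eq_bigr => c cS; rewrite card_forest; last by rewrite disjoints1 !inE eqxx.
  by rewrite cards1 [in RHS](cardsD1 c S) cS.
rewrite sum_nat_const; case: #|S| S0 => // -[|n] _ //=.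
by rewrite mul1n add1n expnS.
Qed.

(** Double counting of forests with a marked tree of size j, sorted by the vertex set [S] of that
    tree: it can be any rooted tree on [S], and the rest is any forest on the complement. *)
Lemma tree_sumS j V w s : 0 < j ->
  tree_sum j V w s.+1 =
  \sum_(S : {set T} | (S \subset V) && (#|S| == j))
     j ^ j.-1 * tree_sum j (V :\: S) (w \o succn) s.
Proof.
move=> j0.
pose G K h := w #|K| * (nb_trees j K h).-1 ^_ s.

(* In X^_(s + 1) = X (X - 1)^_s the factor X marks a root [c] whose tree has j points, and [G] keeps
   the falling factorial of the trees left over. *)
pose cond (p : {set T} * {ffun T -> T} * T) :=
  let: (K, h, c) := p in
  [&& K \subset V, forest K (V :\: K) h, c \in K & #|tree h c| == j].
transitivity (\sum_(p | cond p) G p.1.1 p.1.2).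
  rewrite /tree_sum pair_big_dep /=.
  rewrite (eq_bigl (fun p : {set T} * {ffun T -> T} * T =>
    ((p.1.1 \subset V) && forest p.1.1 (V :\: p.1.1) p.1.2) &&
    ((p.2 \in p.1.1) && (#|tree p.1.2 p.2| == j)))); last first.
    by case=> -[K h] c /=; rewrite -!andbA.
  rewrite -(pair_big_dep
    (fun p : {set T} * {ffun T -> T} => (p.1 \subset V) && forest p.1 (V :\: p.1) p.2)
    (fun p c => (c \in p.1) && (#|tree p.2 c| == j)) (fun p c => G p.1 p.2)) /=.
  apply: eq_bigr => -[K h] /= _.
  rewrite ffactnS mulnCA {1}/nb_trees -sum1dep_card big_distrl /=.
  by apply: eq_bigr => c _; rewrite mul1n.
rewrite (partition_big (fun p => tree p.1.2 p.2)
  (fun S : {set T} => (S \subset V) && (#|S| == j))); last first.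
  case=> -[K h] c /= /and4P[sKV fh cK ->]; rewrite andbT.
  apply/subsetP => x; rewrite inE; apply: contraLR => xV; apply/negP => /fix_reach e.
  have xc : x = c by apply/e/(forest_fix fh); rewrite inE (negPf xV) andbF.
  by move: xV; rewrite xc (subsetP sKV).
apply: eq_bigr => S /andP[sSV /eqP Sj].
have <- : \sum_(c in S) \sum_(h | forest [set c] (S :\ c) h) 1 = j ^ j.-1.
  by rewrite card_rooted_trees Sj.
rewrite big_distrl big_mkcond /=.
transitivity (\sum_p \sum_c
    if cond (p, c) && (tree p.2 c == S) then G p.1 p.2 else 0).
  by rewrite pair_bigA; apply: eq_bigr => -[p c] _.
rewrite exchange_big [RHS]big_mkcond /=; apply: eq_bigr => c _.
case: ifPn => cS; last first.
  rewrite big1 // => -[K h] _; case: ifP => // /andP[_ /eqP tS].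
  by move: cS; rewrite -tS tree_root.
transitivity (\sum_K \sum_h
    if cond (K, h, c) && (tree h c == S) then G K h else 0).
  by rewrite pair_bigA; apply: eq_bigr => -[K h] _.
transitivity (\sum_(K : {set T} | [&& K \subset V, c \in K & K :\ c \subset V :\: S])
  \sum_(h1 | forest [set c] (S :\ c) h1)
  \sum_(h2 | forest (K :\ c) ((V :\: S) :\: (K :\ c)) h2)
     w #|K :\ c|.+1 * nb_trees j (K :\ c) h2 ^_ s).
  rewrite [RHS]big_mkcond; apply: eq_bigr => K _.
  rewrite -big_mkcond; case: ifPn => [/and3P[sKV cK sKS]|nK]; last first.
    rewrite big_pred0 // => h; apply: contraNF nK.
    move=> /andP[/and4P[sKV fh cK _] tS]; rewrite sKV cK /=.
    have : forest K (V :\: K) h && (tree h c == S) by rewrite fh.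
    by rewrite (forest_peel_tree _ sKV cK sSV cS) => /and3P[].
  transitivity (\sum_(h | forest [set c] (S :\ c) (restr S h) &&
      forest (K :\ c) ((V :\: S) :\: (K :\ c)) (restr (~: S) h)) G K h).
    apply: eq_bigl => h.
    have -> : cond (K, h, c) && (tree h c == S) = forest K (V :\: K) h && (tree h c == S).
      by rewrite /= sKV cK /=; case: (tree h c =P S) => [->|]; rewrite ?Sj ?eqxx ?andbT ?andbF.
    by rewrite (forest_peel_tree _ sKV cK sSV cS) sKS andbT.
  rewrite sum_glue; first last.
  - move=> h fh; apply: forest_idC fh _.
    by apply/subsetP => x; rewrite !inE => ->; rewrite /= andbF.
  - by move=> h fh; apply: forest_id fh _; rewrite subD1set.
  apply: eq_bigr => h1 f1; apply: eq_bigr => h2 f2.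
  have e2 : restr (~: S) h2 = h2.
    by apply: forest_idC f2 _; apply/subsetP => x; rewrite !inE => ->; rewrite /= andbF.
  have e1 : restr S h1 = h1 by apply: forest_id f1 _; rewrite subD1set.
  have /andP[fg /eqP tg] : forest K (V :\: K) (glue S h1 h2) && (tree (glue S h1 h2) c == S).
    by rewrite (forest_peel_tree _ sKV cK sSV cS) restr_glue restrC_glue e1 e2 f1 f2.
  rewrite /G (nb_trees_peel sKV cK sSV cS Sj fg tg) restrC_glue e2.
  by rewrite (cardsD1 c K) cK.
(* The remaining roots form an arbitrary subset of [V :\: S], and the marked root is added back to
   it. *)
rewrite (reindex_onto (fun K => c |: K) (fun K => K :\ c)) /=; last first.
  by move=> K /and3P[_ cK _]; rewrite setD1K.
rewrite big_distrl exchange_big /=; apply: eq_bigr => h1 _; rewrite mul1n /tree_sum.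
apply: eq_big => [K|K].
  rewrite setU11 /=; apply/idP/idP => [/andP[/andP[_ sK] /eqP e]|sK]; first by rewrite -e.
  have cK : c \notin K by apply: contraL cS => /(subsetP sK); rewrite inE => /andP[].
  rewrite setU1K // eqxx sK !andbT subUset sub1set (subsetP sSV) //.
  by apply: subset_trans sK (subsetDl _ _).
by move=> /andP[_ /eqP ->].
Qed.

(** Ordered choices of s disjoint blocks of j points among n, a multinomial coefficient. *)
Fixpoint block_choices j n s :=
  if s is s'.+1 then 'C(n, j) * block_choices j (n - j) s' else 1.

Lemma block_choicesE j n s : s * j <= n ->
  block_choices j n s * (j`! ^ s * (n - s * j)`!) = n`!.
Proof.
elim: s n => [|s IH] n le /=; first by rewrite mul0n subn0 !mul1n.
have jn : j <= n by apply: leq_trans le; rewrite mulSn leq_addr.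
rewrite -(bin_fact jn) -(IH (n - j)); last by rewrite leq_subRL // -mulSn.
by rewrite -subnDA -mulSn expnS; ring.
Qed.

Lemma tree_sumE j V w s : 0 < j ->
  tree_sum j V w s =
  block_choices j #|V| s * (j ^ j.-1) ^ s *
  \sum_(m < (#|V| - s * j).+1)
     'C(#|V| - s * j, m) * (w (m + s) * forest_count m (#|V| - s * j - m)).
Proof.
move=> j0; elim: s V w => [|s IH] V w.
  rewrite mul0n subn0 !mul1n /tree_sum.
  rewrite -(sum_subsets V (fun m => w (m + 0) * forest_count m (#|V| - m))).
  apply: eq_bigr => K sKV; rewrite addn0.
  transitivity (w #|K| * \sum_(h | forest K (V :\: K) h) 1).
    by rewrite big_distrr; apply: eq_bigr => h _; rewrite ffactn0.
  rewrite card_forest ?cardsD ?(setIidPr sKV) //.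
  by rewrite -setI_eq0; apply/eqP/setP=> x; rewrite !inE; case: (x \in K).
rewrite tree_sumS //.
transitivity (\sum_(S : {set T} | (S \subset V) && (#|S| == j)) j ^ j.-1 *
  (block_choices j (#|V| - j) s * (j ^ j.-1) ^ s *
  \sum_(m < (#|V| - s.+1 * j).+1)
     'C(#|V| - s.+1 * j, m) * (w (m + s.+1) * forest_count m (#|V| - s.+1 * j - m)))).
  apply: eq_bigr => S /andP[sSV /eqP Sj]; rewrite IH cardsD (setIidPr sSV) Sj.
  rewrite -subnDA -mulSn; congr (_ * (_ * _)).
  by apply: eq_bigr => m _; rewrite /= addnS.
by rewrite sum_nat_cond_const /= cards_draws expnS; ring.
Qed.

Lemma sum_ffact_trees j s : 0 < j ->
  \sum_f (nb_trees j (core f) (restr (~: core f) f)) ^_ s =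
  block_choices j #|T| s * (j ^ j.-1) ^ s *
  \sum_(m < (#|T| - s * j).+1)
     'C(#|T| - s * j, m) * ((m + s)`! * forest_count m (#|T| - s * j - m)).
Proof.
move=> j0; rewrite (sum_core_decomp (fun K h => (nb_trees j K h) ^_ s)).
rewrite -cardsT -(tree_sumE [set: T] factorial s j0) /tree_sum.
apply: eq_big => K; first by rewrite subsetT.
by rewrite setTD big_distrr.
Qed.

Lemma reach_restr K f x c : c \in K ->
  (exists i, iter i (restr (~: K) f) x = c) <->
  (exists i, iter i f x = c /\ (forall k, k < i -> iter k f x \notin K)).
Proof.
move=> cK; split=> -[i]; elim: i x => [|i IH] x.
- by move=> /= ->; exists 0.
- rewrite iterSr ffunE in_setC; case: ifPn => xK.
    move=> /IH[k [e H]]; exists k.+1; split; first by rewrite iterSr.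
    by case=> [|l] // lk; rewrite iterSr H.
  by rewrite ffunE => /IH.
- by move=> [/= -> _]; exists 0.
- move=> [e H]; have [|k ek] := IH (f x).
    split; first by rewrite -iterSr.
    by move=> k ki; rewrite -iterSr H.
  exists k.+1; rewrite iterSr ffunE in_setC; have /= -> := H 0 isT.
  by [].
Qed.

End Trees.

From mathcomp Require Import all_classical all_reals all_analysis.
From mathcomp Require Import measurable_realfun.
Import Order.TTheory GRing.Theory Num.Theory.
Import numFieldNormedType.Exports.
Local Open Scope classical_set_scope.
Local Open Scope ring_scope.

(** * Factorial moments and the number of cyclic points *)

Lemma cyclicP n (f : mapping n) c : cyclic f c <-> c \in core f.
Proof.
split=> [[[|l] [// _ e]]|/coreP[i e]]; first by apply/coreP; exists l.
by exists i.+1.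
Qed.

Lemma Xnj_trees n j (f : mapping n) :
  Xnj j f = nb_trees j (core f) (restr (~: core f) f).
Proof.
have tsz c : c \in core f -> tree_size f c = #|tree (restr (~: core f) f) c|.
  move=> cc; apply: eq_card => x; rewrite !inE.
  apply/asboolP/fconnectP => [/asboolP[k [e [_ H]]]|ex].
    apply: (reach_restr f x cc).2; exists k; split => // i ik.
    by apply/negP => /cyclicP; apply: H.
  have [k [e H]] := (reach_restr f x cc).1 ex.
  apply/asboolP; exists k; split => //; split; first exact/cyclicP.
  by move=> i /H /negP nc /cyclicP.
apply: eq_card => c; rewrite !inE; apply/asboolP/andP => [/asboolP[/cyclicP cc <-]|[cc /eqP <-]].
  by rewrite -tsz //; move: cc; rewrite inE.
have cc' : c \in core f by rewrite inE.
by apply/asboolP; split; [exact/cyclicP | rewrite tsz].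
Qed.

Definition tree_weight N s : nat :=
  (\sum_(m < N.+1) 'C(N, m) * ((m + s)`! * forest_count m (N - m)))%N.

Lemma sum_ffact_Xnj n j s : (0 < j)%N ->
  (\sum_(f : mapping n) (Xnj j f) ^_ s =
   block_choices j n s * (j ^ j.-1) ^ s * tree_weight (n - s * j) s)%N.
Proof.
move=> j0; have := @sum_ffact_trees 'I_n j s j0; rewrite card_ord => <-.
by apply: eq_bigr => f _; rewrite Xnj_trees.
Qed.

(** * Distribution and rising factorial moments of the number of cyclic points *)

Section CyclicMoments.
Variable R : realType.

Definition no_collision N m : R := (N ^_ m)%:R / N%:R ^+ m.

(** The factor [no_collision N m * (m%:R / N%:R)] is the probability of having m cyclic points: N^_m
    choices of a permuted core, times m N^(N - m - 1) forests, over N^N. *)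
Definition cyclic_moment N s : R :=
  \sum_(m < N.+1) no_collision N m * (m%:R / N%:R) * ((m + s) ^_ s)%:R.

Lemma forest_countE N m : (0 < N)%N -> (m <= N)%N ->
  (forest_count m (N - m) * N ^ m.+1 = m * N ^ N)%N.
Proof.
move=> N0 mN; case E : (N - m)%N => [|u] /=.
  by rewrite mul1n (_ : m = N) ?expnS //; lia.
have -> : (m + u.+1 = N)%N by lia.
rewrite -mulnA -expnD; congr (_ * _ ^ _)%N; lia.
Qed.

Lemma tree_weightE N s : (0 < N)%N ->
  (tree_weight N s)%:R = N%:R ^+ N * cyclic_moment N s :> R.
Proof.
move=> N0; rewrite natr_sum mulr_sumr; apply: eq_bigr => m _.
have mN : (m <= N)%N by rewrite -ltnS.
have NN0 : (N%:R : R) != 0 by rewrite pnatr_eq0 -lt0n.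
rewrite !natrM.
have -> : (forest_count m (N - m))%:R = m%:R * N%:R ^+ N / N%:R ^+ m.+1 :> R.
  rewrite -natrX -natrM -forest_countE // natrM natrX mulfK //.
  by rewrite expf_neq0.
have -> : (m + s)`! = ((m + s) ^_ s * m`!)%N.
  by rewrite -(@ffact_fact (m + s) s) ?leq_addl // addnK.
have e : ('C(N, m))%:R * (m`!)%:R = (N ^_ m)%:R :> R by rewrite -natrM bin_ffact.
rewrite /no_collision -e natrM exprS; field.
by rewrite NN0 expf_neq0.
Qed.

Lemma no_collisionS N m : (0 < N)%N -> (m <= N)%N ->
  no_collision N m.+1 = no_collision N m * (1 - m%:R / N%:R).
Proof.
move=> N0 mN; have NN0 : (N%:R : R) != 0 by rewrite pnatr_eq0 -lt0n.
rewrite /no_collision ffactnSr natrM natrB // exprS; field.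
by rewrite NN0 expf_neq0.
Qed.

Lemma no_collision_ge0 N m : 0 <= no_collision N m.
Proof. by rewrite divr_ge0. Qed.

Lemma no_collision_end N : no_collision N N.+1 = 0.
Proof. by rewrite /no_collision ffact_small // mul0r. Qed.

(** The probability of m cyclic points is the difference of two consecutive values of
    [no_collision], which starts at 1 and ends at 0. *)
Lemma cyclic_moment0 N : (0 < N)%N -> cyclic_moment N 0 = 1.
Proof.
move=> N0; rewrite /cyclic_moment.
transitivity (\sum_(0 <= m < N.+1) ((- no_collision N m.+1) - (- no_collision N m))).
  rewrite big_mkord; apply: eq_bigr => m _; rewrite no_collisionS -1?ltnS //.
  by rewrite ffactn0 mulr1; ring.
rewrite telescope_sumr // no_collision_end oppr0 sub0r opprK.
by rewrite /no_collision ffactn0 expr0 divr1.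
Qed.

Lemma cyclic_moment_rec N s : (0 < N)%N ->
  cyclic_moment N s.+2 =
  s.+2%:R * (N%:R * cyclic_moment N s + cyclic_moment N s.+1).
Proof.
move=> N0; have NN0 : (N%:R : R) != 0 by rewrite pnatr_eq0 -lt0n.
(* A summation by parts: [T] vanishes at 0 through the factor m and at N + 1 because N + 1 points
   among N must collide, and its increments are the terms of the difference of the two sides. *)
pose T m : R := - no_collision N m * m%:R * (m%:R - 1) * ((m + s) ^_ s)%:R.
have : \sum_(0 <= m < N.+1) (T m.+1 - T m) = 0.
  by rewrite telescope_sumr // /T no_collision_end oppr0 !mul0r mulr0 !mul0r subr0.
rewrite big_mkord => e; apply/eqP; rewrite -subr_eq0 -{}e; apply/eqP.
rewrite mulr_sumr -big_split /= mulr_sumr -sumrB; apply: eq_bigr => m _.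
have mN : (m <= N)%N by rewrite -ltnS.
have wS k l : ((k + l.+1) ^_ l.+1)%:R = (k%:R + l%:R + 1) * ((k + l) ^_ l)%:R :> R.
  by rewrite addnS ffactSS natrM -addn1 !natrD.
have w1 : (m%:R + 1) * ((m.+1 + s) ^_ s)%:R = (m%:R + s%:R + 1) * ((m + s) ^_ s)%:R :> R.
  rewrite -wS addnS ffactnSr natrM mulrC addSn -addSn addnK -addn1 natrD; ring.
rewrite /T no_collisionS // !wS.
have -> : m.+1%:R = m%:R + 1 :> R by rewrite -addn1 natrD.
have -> (z : R) : - (no_collision N m * z) * (m%:R + 1) * (m%:R + 1 - 1) * ((m.+1 + s) ^_ s)%:R
   = - (no_collision N m * z) * m%:R * ((m%:R + 1) * ((m.+1 + s) ^_ s)%:R) by ring.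
rewrite w1 -[s.+2]addn2 -[s.+1]addn1 !natrD; field.
by [].
Qed.

Lemma cyclic_moment_gt0 N s : (0 < N)%N -> 0 < cyclic_moment N s.
Proof.
move=> N0; rewrite /cyclic_moment.
apply: lt_le_trans (_ : cyclic_moment N 0 <= _); first by rewrite cyclic_moment0.
apply: ler_sum => m _; rewrite ffactn0 ler_wpM2l //.
  by rewrite mulr_ge0 ?no_collision_ge0 ?divr_ge0.
by rewrite ler_nat ffact_gt0 leq_addl.
Qed.

Lemma cyclic_moment_logconvex N s : (0 < N)%N ->
  cyclic_moment N s.+1 ^+ 2 <= cyclic_moment N s * cyclic_moment N s.+2.
Proof.
move=> N0; have As0 := cyclic_moment_gt0 s N0; have As1 := cyclic_moment_gt0 s.+1 N0.
(* The minimiser of the quadratic in Cauchy-Schwarz. The variable is C + s + 1, whose second moment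
   under the weight of order s is the difference of the moments of orders s + 2 and s + 1; this
   gives slightly more than the claim. *)
set c := cyclic_moment N s.+1 / cyclic_moment N s.
have : 0 <= (cyclic_moment N s.+2 - cyclic_moment N s.+1) - c *+ 2 * cyclic_moment N s.+1
             + c ^+ 2 * cyclic_moment N s.
  rewrite /cyclic_moment !mulr_sumr -!sumrB -big_split /=; apply: sumr_ge0 => m _.
  have wS k l : ((k + l.+1) ^_ l.+1)%:R = (k%:R + l%:R + 1) * ((k + l) ^_ l)%:R :> R.
    by rewrite addnS ffactSS natrM -addn1 !natrD.
  rewrite !wS -[s.+1]addn1 natrD.
  set P := _ * (_ / _); set w := (_ ^_ _)%:R; set x := m%:R.
  have -> : P * ((x + (s%:R + 1%:R) + 1) * ((x + s%:R + 1) * w)) - P * ((x + s%:R + 1) * w) -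
     c *+ 2 * (P * ((x + s%:R + 1) * w)) + c ^+ 2 * (P * w) =
     P * w * (x + s%:R + 1 - c) ^+ 2 by ring.
  by rewrite mulr_ge0 ?sqr_ge0 // mulr_ge0 // mulr_ge0 ?no_collision_ge0 ?divr_ge0.
have -> : c *+ 2 * cyclic_moment N s.+1 = 2 * (cyclic_moment N s.+1 ^+ 2 / cyclic_moment N s).
  by rewrite /c; ring.
have -> : c ^+ 2 * cyclic_moment N s = cyclic_moment N s.+1 ^+ 2 / cyclic_moment N s.
  by rewrite /c; field; rewrite gt_eqF.
move=> H; rewrite mulrC -ler_pdivrMr //; lra.
Qed.

End CyclicMoments.

(** * Log-convex sequences *)

(** Here x and y stand for [a 1] and [mu 1], g for [mu] at 2k, d for [odd_coeff k], K for k + 1, and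
    a0, ..., a3 for the terms from 2k to 2k + 3. Log-convexity at 2k and 2k + 1 gives y^2 <= 2 K q
    <= y^2 (1 + 1 / (2 K)) with q = g^2 / d^2, and the same for x up to errors of order eta. Hence
    x^2 and y^2 are close. *)
Lemma wallis_estimate (R : realType) (e y K d g eta x a0 a1 a2 a3 : R) :
  0 < e -> 0 < y -> 1 <= K -> 1 <= d -> 0 < g -> 0 <= x ->
  2 * y < e * K -> eta = e * y / 8 ->
  - (0 - (a1 - d * x) * (a1 + d * x)) < eta ->
  0 - (a1 - d * x) * (a1 + d * x) < eta ->
  - (g * (2 * K * g) - a0 * a2) < eta ->
  - (0 - ((a1 - d * x) * a3 + (a3 - (2 * K + 1) * d * x) * (d * x))) < eta ->
  2 * K * g * (2 * K * g) - a2 * a2 < eta ->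
  a1 ^+ 2 <= a0 * a2 -> a2 ^+ 2 <= a1 * a3 ->
  (d * y) ^+ 2 <= g * (2 * K * g) ->
  (2 * K * g) ^+ 2 <= d * y * ((2 * K + 1) * d * y) ->
  `|y - x| < e.
Proof.
move=> e0 y0 K1 d1 g0 x0 kP etaE H1 H1' H2 H3 H4 Z1 Z2 Y1 Y2.
have dx : (d * x) ^+ 2 <= 2 * K * g ^+ 2 + 2 * eta by nra.
have dx' : (2 * K * g) ^+ 2 <= (2 * K + 1) * (d * x) ^+ 2 + 2 * eta by nra.
have d2 : 1 <= d ^+ 2 by nra.
set q := g ^+ 2 / d ^+ 2.
have gq : g ^+ 2 = q * d ^+ 2 by rewrite /q divfK // gt_eqF // (lt_le_trans _ d2).
have q0 : 0 <= q by rewrite divr_ge0 ?sqr_ge0.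
have eta0 : 0 < eta by rewrite etaE divr_gt0 ?mulr_gt0.
have cancel (z t : R) : 0 <= t -> d ^+ 2 * z <= t -> z <= t.
  move=> t0; case: (lerP z 0) => z0 h; first exact: le_trans z0 t0.
  by apply: le_trans h; rewrite ler_peMl // ltW.
have X1 : x ^+ 2 - 2 * K * q <= 2 * eta.
  apply: cancel; [lra|]; move: dx; rewrite gq exprMn; lra.
have X2 : (2 * K) ^+ 2 * q - (2 * K + 1) * x ^+ 2 <= 2 * eta.
  apply: cancel; [lra|]; move: dx'; rewrite !exprMn gq; lra.
have P1 : y ^+ 2 <= 2 * K * q.
  rewrite -(ler_pM2l (lt_le_trans ltr01 d2)); move: Y1; rewrite exprMn => /le_trans; apply.
  by rewrite mulrCA -expr2 gq; lra.
have P2 : (2 * K) ^+ 2 * q <= (2 * K + 1) * y ^+ 2.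
  rewrite -(ler_pM2l (lt_le_trans ltr01 d2)); move: Y2; rewrite !exprMn gq; lra.
have Q : 2 * K * q <= y ^+ 2 + y ^+ 2 / (2 * K).
  rewrite -(@ler_pM2l _ (2 * K)); last lra.
  have -> : 2 * K * (y ^+ 2 + y ^+ 2 / (2 * K)) = (2 * K + 1) * y ^+ 2.
    by field; lra.
  by move: P2; rewrite !expr2; lra.
have small : y ^+ 2 / (2 * K) < e * y / 4.
  rewrite ltr_pdivrMr; last lra.
  have -> : e * y / 4 * (2 * K) = y * (e * K) / 2 by field.
  have : y * (2 * y) < y * (e * K) by rewrite ltr_pM2l.
  by rewrite expr2; lra.
have U : x ^+ 2 - y ^+ 2 < e * y by lra.
have L : y ^+ 2 - x ^+ 2 < e * y.
  have : (2 * K + 1) * y ^+ 2 <= (2 * K + 1) * (2 * K * q) by rewrite ler_pM2l //; lra.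
  have := Q; move=> Q' P3.
  suff : (2 * K + 1) * (y ^+ 2 - x ^+ 2) <= (2 * K + 1) * (e * y / 2) by rewrite ler_pM2l; nra.
  have : (2 * K + 1) * (e * y / 4) >= e * y / 4 by rewrite ler_peMl //; nra.
  move: X2; rewrite !expr2 etaE; nra.
(* Since x >= 0, |y - x| y <= |y^2 - x^2| < e y. *)
apply/ltr_normlP; split.
  rewrite opprB -(ltr_pM2r y0); nra.
rewrite -(ltr_pM2r y0); nra.
Qed.

Section WallisPinning.
Variables (R : realType) (T : Type) (F : set_system T).
Hypothesis FF : ProperFilter F.
Variables (eps : T -> R) (a : nat -> T -> R) (mu : nat -> R).
Hypothesis eps_cvg : eps @ F --> (0 : R).
Hypothesis eps_ge0 : forall i, 0 <= eps i <= 1.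
Hypothesis a0 : forall i, a 0 i = 1.
Hypothesis a_ge0 : forall s i, 0 <= a s i.
Hypothesis a_rec : forall s i, a s.+2 i = s.+2%:R * (a s i + eps i * a s.+1 i).
Hypothesis a_lc : forall s i, a s.+1 i ^+ 2 <= a s i * a s.+2 i.
Hypothesis mu0 : mu 0 = 1.
Hypothesis mu_gt0 : forall s, 0 < mu s.
Hypothesis mu_rec : forall s, mu s.+2 = s.+2%:R * mu s.
Hypothesis mu_lc : forall s, mu s.+1 ^+ 2 <= mu s * mu s.+2.

(** Two consecutive terms are bounded at once because the recurrence has order two. It says nothing
    about [a 1], whose bound comes from log-convexity. *)
Let a_bounded s : exists M, forall i, a s i <= M.
Proof.
suff: (exists M, forall i, a s i <= M) /\ (exists M, forall i, a s.+1 i <= M) by case.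
elim: s => [|s [[M IH1] [M' IH2]]].
  split; first by exists 1 => i; rewrite a0.
  (* a_1^2 <= a_2 = 2 (1 + eps a_1) <= 2 + 2 a_1, so a_1 <= 1 + sqrt 3 < 3. *)
  exists 3 => i; have := a_lc 0 i; rewrite a_rec a0 /=.
  have := a_ge0 1 i; have := eps_ge0 i => /andP[]; move: (a 1 i) (eps i) => x e.
  by move=> *; nra.
split; first by exists M'.
exists (s.+2%:R * (M + M')) => i; rewrite a_rec ler_wpM2l // lerD //.
have := eps_ge0 i => /andP[e0 e1]; apply: le_trans (IH2 i).
by rewrite ler_piMl.
Qed.

Let cvg0_bounded (e g : T -> R) M : e @ F --> (0 : R) -> (forall i, `|g i| <= M) ->
  (fun i => e i * g i) @ F --> (0 : R).
Proof.
move=> e0 gM; apply/norm_cvg0P.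
have : (fun i => `|e i| * M) @ F --> (0 : R).
  rewrite -(mul0r M); apply: cvgM; last exact: cvg_cst.
  by apply/norm_cvg0P.
apply: squeeze_cvgr; last exact: cvg_cst.
by apply: nearW => i /=; rewrite normr_ge0 normrM ler_wpM2l.
Qed.

Let eps_a s : (fun i => eps i * a s i) @ F --> (0 : R).
Proof.
have [M aM] := a_bounded s; apply: (@cvg0_bounded _ _ M) => // i.
by rewrite ger0_norm.
Qed.

Let a_even k : a k.*2 @ F --> mu k.*2.
Proof.
elim: k => [|k IH].
  rewrite /= mu0; have -> : a 0 = fun=> 1 by apply/funext => i; rewrite a0.
  exact: cvg_cst.
rewrite doubleS mu_rec.
have -> : a k.*2.+2 = (fun i => k.*2.+2%:R * (a k.*2 i + eps i * a k.*2.+1 i)).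
  by apply/funext => i; rewrite a_rec.
apply: cvgM; first exact: cvg_cst.
by rewrite -[X in _ --> X]addr0; apply: cvgD.
Qed.

(** The double factorial (2k + 1)!!. *)
Fixpoint odd_coeff k : R := if k is k'.+1 then k.*2.+1%:R * odd_coeff k' else 1.

Let mu_odd k : mu k.*2.+1 = odd_coeff k * mu 1.
Proof. by elim: k => [|k IH]; rewrite ?mul1r // doubleS mu_rec IH mulrA. Qed.

Let odd_coeff_ge1 k : 1 <= odd_coeff k.
Proof.
elim: k => [//|k IH]; rewrite /odd_coeff -/odd_coeff.
by rewrite (le_trans IH) // ler_peMl ?ler1n // (le_trans ler01).
Qed.

(** Stated as a vanishing difference because the convergence of [a 1] is not yet known at this
    point. *)
Let a_odd k : (fun i => a k.*2.+1 i - odd_coeff k * a 1 i) @ F --> (0 : R).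
Proof.
elim: k => [|k IH].
  rewrite [X in X @ _](_ : _ = cst 0); first exact: cvg_cst.
  by apply/funext => i; rewrite /= mul1r subrr.
rewrite [X in X @ _](_ : _ = (fun i => k.*2.+3%:R *
    ((a k.*2.+1 i - odd_coeff k * a 1 i) + eps i * a k.*2.+2 i))); last first.
  by apply/funext => i; rewrite doubleS a_rec /odd_coeff -/odd_coeff doubleS; ring.
rewrite -[X in _ --> X](mulr0 k.*2.+3%:R); apply: cvgM; first exact: cvg_cst.
by rewrite -[X in _ --> X]addr0; apply: cvgD.
Qed.

Let a1_cvg : a 1 @ F --> mu 1.
Proof.

set y := mu 1; have y0 : 0 < y by exact: mu_gt0.
apply/cvgrPdist_lt => e e0.
(* The order k is chosen before the limit: it makes the Wallis bracket around [mu 1] short compared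
   with e, and stays fixed while the filter makes the errors smaller than eta. *)
have [k kP] : exists k : nat, 2 * y < e * k.+1%:R.
  exists (Num.bound (2 * y / e)).
  have : 2 * y / e < (Num.bound (2 * y / e))%:R.
    by apply: archi_boundP; rewrite divr_ge0 ?mulr_ge0 // ltW.
  rewrite ltr_pdivrMr // [X in _ < X]mulrC => /lt_le_trans; apply.
  by rewrite ler_pM2l // ler_nat.
set d := odd_coeff k; have d1 : 1 <= d by exact: odd_coeff_ge1.
set d' := odd_coeff k.+1; have d'E : d' = k.*2.+3%:R * d by rewrite /d' /odd_coeff -/odd_coeff doubleS.
set g := mu k.*2; have g0 : 0 < g by exact: mu_gt0.
have gE : mu k.*2.+2 = k.*2.+2%:R * g by rewrite mu_rec.
have [M1 aM1] := a_bounded k.*2.+1; have [M3 aM3] := a_bounded k.+1.*2.+1.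
have [M aM] := a_bounded 1.
have od := a_odd k; have od' := a_odd k.+1; rewrite -/d -/d' in od od'.
have H1 : (fun i => (a k.*2.+1 i - d * a 1 i) * (a k.*2.+1 i + d * a 1 i)) @ F --> (0 : R).
  apply: (@cvg0_bounded _ _ (M1 + d * M) od) => i.
  have da : 0 <= d * a 1 i by rewrite mulr_ge0 // ltW // (lt_le_trans _ d1).
  rewrite ger0_norm ?addr_ge0 // lerD // ler_wpM2l //.
  by rewrite ltW // (lt_le_trans _ d1).
have H3 : (fun i => (a k.*2.+1 i - d * a 1 i) * a k.+1.*2.+1 i +
    (a k.+1.*2.+1 i - d' * a 1 i) * (d * a 1 i)) @ F --> (0 : R).
  rewrite -[X in _ --> X]addr0; apply: cvgD.
    by apply: (@cvg0_bounded _ _ M3 od) => i; rewrite ger0_norm.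
  apply: (@cvg0_bounded _ _ (d * M) od') => i.
  have da : 0 <= d * a 1 i by rewrite mulr_ge0 // ltW // (lt_le_trans _ d1).
  by rewrite ger0_norm // ler_wpM2l // ltW // (lt_le_trans _ d1).
have H2 : (fun i => a k.*2 i * a k.+1.*2 i) @ F --> g * mu k.*2.+2.
  by apply: cvgM; exact: a_even.
have H4 : (fun i => a k.+1.*2 i * a k.+1.*2 i) @ F --> mu k.*2.+2 * mu k.*2.+2.
  by apply: cvgM; exact: a_even.
set eta := e * y / 8; have eta0 : 0 < eta by rewrite divr_gt0 ?mulr_gt0.
have Y1 := mu_lc k.*2; have Y2 := mu_lc k.*2.+1; have Y3 := mu_odd k; have Y4 := mu_odd k.+1.
rewrite doubleS -/d' -/y in Y4; rewrite -/d -/y in Y3.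
move/cvgrPdist_lt: H1 => /(_ _ eta0) H1; move/cvgrPdist_lt: H2 => /(_ _ eta0) H2.
move/cvgrPdist_lt: H3 => /(_ _ eta0) H3; move/cvgrPdist_lt: H4 => /(_ _ eta0) H4.
near=> i.
have N1 : `|0 - (a k.*2.+1 i - d * a 1 i) * (a k.*2.+1 i + d * a 1 i)| < eta by near: i.
have N2 : `|g * mu k.*2.+2 - a k.*2 i * a k.+1.*2 i| < eta by near: i.
have N3 : `|0 - ((a k.*2.+1 i - d * a 1 i) * a k.+1.*2.+1 i +
    (a k.+1.*2.+1 i - d' * a 1 i) * (d * a 1 i))| < eta by near: i.
have N4 : `|mu k.*2.+2 * mu k.*2.+2 - a k.+1.*2 i * a k.+1.*2 i| < eta by near: i.
have Z1 := a_lc k.*2 i; have Z2 := a_lc k.*2.+1 i.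
rewrite doubleS in N2 N3 N4.
move: N1 N2 N3 N4 Z1 Z2 Y1 Y2; rewrite {}Y3 {}Y4 {}gE {}d'E.
have x0 := a_ge0 1 i; move: x0.
have dbl : k.*2.+2%:R = 2 * k.+1%:R :> R by rewrite -natrM mul2n.
have dbl' : k.*2.+3%:R = 2 * k.+1%:R + 1 :> R by rewrite -dbl -natr1.
rewrite dbl dbl' -/g.
have : 1 <= k.+1%:R :> R by rewrite ler1n.
move: kP (a 1 i) (a k.*2 i) (a k.*2.+1 i) (a k.*2.+2 i) (a k.*2.+3 i) => kP x a_0 a_1 a_2 a_3.
move: kP; move: (k.+1%:R : R) => K kP K1 x0.
move=> /ltr_normlP[P1 P1'] /ltr_normlP[P2 _] /ltr_normlP[P3 _] /ltr_normlP[_ P4] Z1 Z2 Y1 Y2.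
exact: (@wallis_estimate R e y K d g eta x a_0 a_1 a_2 a_3).
Unshelve. all: by end_near.
Qed.

Lemma wallis_pinning s : a s @ F --> mu s.
Proof.
rewrite -(odd_double_half s); case: (odd s); last exact: a_even.
rewrite add1n mu_odd.
rewrite [X in X @ _](_ : _ = (fun i => (a s./2.*2.+1 i - odd_coeff s./2 * a 1 i) +
    odd_coeff s./2 * a 1 i)); last by apply/funext => i; rewrite subrK.
rewrite -[X in _ --> X]add0r; apply: cvgD; first exact: a_odd.
by apply: cvgM; [exact: cvg_cst | exact: a1_cvg].
Qed.

End WallisPinning.

(** * Asymptotics of the factorial moments *)

Section FactorialMoments.
Variable R : realType.

Definition stirling_ratio n : R := n`!%:R * expR n%:R / n%:R ^+ n.

Lemma stirling_ratio_gt0 n : 0 < stirling_ratio n.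
Proof.
case: n => [|n]; first by rewrite /stirling_ratio !expr0 divr1 mul1r expR_gt0.
by rewrite divr_gt0 ?mulr_gt0 ?expR_gt0 ?ltr0n ?fact_gt0 ?exprn_gt0.
Qed.

Lemma stirling_ratioS n :
  stirling_ratio n.+1 = stirling_ratio n * (expR 1 * (n%:R / n.+1%:R) ^+ n).
Proof.
rewrite /stirling_ratio -[in expR n.+1%:R]natr1 expRD factS natrM exprS expr_div_n.
have q0 : n%:R ^+ n != 0 :> R.
  by case: n => [|n]; rewrite ?expr0 ?oner_eq0 // expf_neq0 // pnatr_eq0.
have n1 : n.+1%:R != 0 :> R by rewrite pnatr_eq0.
have q1 := expf_neq0 n n1; move: q0 q1 n1.
move: (n%:R ^+ n : R) (n.+1%:R ^+ n : R) (n.+1%:R : R) => x y z *; field.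
by do !(apply/andP; split).
Qed.

(** For n > 0 the quotient of consecutive terms is e / (1 + 1/n)^n, and 1 + 1/n <= exp(1/n). *)
Lemma stirling_ratio_le n : stirling_ratio n <= stirling_ratio n.+1.
Proof.
rewrite stirling_ratioS ler_peMr ?(ltW (stirling_ratio_gt0 _)) //.
case: n => [|n]; first by rewrite expr0 mulr1 ltW // expR_gt1.
have -> : n.+1%:R / n.+2%:R = (1 + n.+1%:R^-1)^-1 :> R.
  have : 0 < n.+1%:R :> R by [].
  by rewrite -[n.+2%:R]natr1; move: (n.+1%:R : R) => x x0; field; do ?(apply/andP; split); lra.
rewrite exprVn ler_pdivlMr ?mul1r; last by rewrite exprn_gt0 // addr_gt0.
have -> : expR 1 = expR (n.+1%:R^-1) ^+ n.+1 :> R.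
  by rewrite -expRM_natr mulVf.
by rewrite lerXn2r ?nnegrE ?expR_ge0 ?addr_ge0 // expR_ge1Dx.
Qed.

(** Equivalent to e (1 - 1/(n + 1))^(n + 1) <= 1, which follows from 1 - z <= exp(-z). *)
Lemma stirling_ratio_ge n : (0 < n)%N ->
  stirling_ratio n.+1 / n.+1%:R <= stirling_ratio n / n%:R.
Proof.
move=> n0; have n0' : 0 < n%:R :> R by rewrite ltr0n.
rewrite stirling_ratioS -mulrA ler_pM2l ?stirling_ratio_gt0 //.
rewrite -(ler_pM2l n0') divff ?gt_eqF //.
have -> : n%:R * (expR 1 * (n%:R / n.+1%:R) ^+ n / n.+1%:R) = expR 1 * (n%:R / n.+1%:R) ^+ n.+1 :> R.
  by rewrite [in RHS]exprS; ring.
have -> : n%:R / n.+1%:R = 1 + (- n.+1%:R^-1) :> R.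
  rewrite -[n.+1%:R]natr1; move: n0'; move: (n%:R : R) => x x0.
  by field; do ?(apply/andP; split); lra.
rewrite -[X in _ <= X](expRxMexpNx_1 1) ler_pM2l ?expR_gt0 //.
have -> : expR (- 1) = expR (- n.+1%:R^-1) ^+ n.+1 :> R.
  by rewrite -expRM_natr mulNr mulVf.
rewrite lerXn2r ?nnegrE ?expR_ge0 ?expR_ge1Dx //.
by rewrite subr_ge0 invf_le1 // ler1n.
Qed.

(** Both outer bounds tend to 1 as soon as N / n does. *)
Lemma stirling_ratio_bounds N n : (0 < N)%N -> (N <= n)%N ->
  1 <= stirling_ratio n / stirling_ratio N <= n%:R / N%:R.
Proof.
move=> N0 /subnK <-; elim: (n - N)%N => [|k /andP[IH1 IH2]].
  by rewrite add0n !divff ?lexx ?gt_eqF ?stirling_ratio_gt0 ?ltr0n.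
have sN := stirling_ratio_gt0 N; have N0' : 0 < N%:R :> R by rewrite ltr0n.
have kN : (0 < k + N)%N by rewrite addn_gt0 N0 orbT.
have kN' : 0 < (k + N)%:R :> R by rewrite ltr0n.
rewrite addSn; apply/andP; split.
  by apply: le_trans IH1 _; rewrite ler_pM2r ?invr_gt0 // stirling_ratio_le.
have := stirling_ratio_ge kN; rewrite ler_pdivrMr ?ltr0n // => le.
rewrite ler_pdivrMr //; apply: le_trans le _.
rewrite ler_pdivrMr // in IH2.
have : stirling_ratio (k + N) / (k + N)%:R <= stirling_ratio N / N%:R.
  by rewrite ler_pdivrMr // mulrAC -mulrA mulrC.
move=> /(ler_wpM2r (ler0n R (k + N).+1)) /le_trans; apply.
by rewrite le_eqVlt; apply/orP; left; apply/eqP; ring.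
Qed.

(** An exact identity arranged as three factors, with limits 1, [mu s] and 1 when s is fixed and j =
    o(n). The power of e in [lambda] is what turns the ratio of factorials into a ratio of
    [stirling_ratio]. *)
Lemma Emap_ffact n j s : (0 < j)%N -> (s * j < n)%N ->
  Emap (R:=R) (fun f : mapping n => ((Xnj j f) ^_ s)%:R) / lambda n j ^+ s =
  stirling_ratio n / stirling_ratio (n - s * j) *
  (cyclic_moment R (n - s * j) s / Num.sqrt (n - s * j)%:R ^+ s) *
  Num.sqrt ((n - s * j)%:R / n%:R) ^+ s.
Proof.
move=> j0 sjn; rewrite /Emap -natr_sum sum_ffact_Xnj // card_ffun card_ord.
have N0 : (0 < n - s * j)%N by rewrite subn_gt0.
have bc := block_choicesE (ltnW sjn).
rewrite !natrM !natrX tree_weightE //.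
have n0 : (0 < n)%N by apply: leq_ltn_trans sjn.
have -> : (block_choices j n s)%:R = n`!%:R / (j`!%:R ^+ s * (n - s * j)`!%:R) :> R.
  rewrite -bc !natrM natrX mulfK // mulf_neq0 ?expf_neq0 ?pnatr_eq0 -?lt0n ?fact_gt0 //.
rewrite /lambda /stirling_ratio sqrtrM ?ler0n // sqrtrV ?ler0n //.
have -> : expR n%:R = expR (n - s * j)%:R * expR j%:R ^+ s :> R.
  by rewrite -expRM_natr -expRD -natrM -natrD mulnC subnK // ltnW // mulnC.
set N := (n - s * j)%N in N0 *.
have q0 : Num.sqrt N%:R != 0 :> R by rewrite gt_eqF // sqrtr_gt0 ltr0n.
have q1 : Num.sqrt n%:R != 0 :> R by rewrite gt_eqF // sqrtr_gt0 ltr0n.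
have f0 k : k`!%:R != 0 :> R by rewrite pnatr_eq0 -lt0n fact_gt0.
have e0 (x : R) : expR x != 0 by rewrite gt_eqF ?expR_gt0.
have jj : (j ^ j.-1)%:R != 0 :> R by rewrite pnatr_eq0 -lt0n expn_gt0 j0.
rewrite natrX in jj.
have n0' : n%:R != 0 :> R by rewrite pnatr_eq0 -lt0n.
have N0' : N%:R != 0 :> R by rewrite pnatr_eq0 -lt0n.
rewrite !expr_div_n !exprMn.
set J := j%:R ^+ j.-1 in jj *.
move: (expf_neq0 s jj) (expf_neq0 s (f0 j)) (expf_neq0 s (e0 j%:R)) (expf_neq0 s q0)
  (expf_neq0 s q1) (expf_neq0 n n0') (expf_neq0 N N0') (f0 n) (f0 N) (e0 N%:R).
move: (J ^+ s) (j`!%:R ^+ s) (expR j%:R ^+ s) (Num.sqrt N%:R ^+ s) (Num.sqrt n%:R ^+ s)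
  (n%:R ^+ n) (N%:R ^+ N) (n`!%:R : R) (N`!%:R : R) (expR N%:R) => *.
field.
by do !(apply/andP; split).
Qed.

(** * Limits of the factorial moments *)

Variable mu : nat -> R.
Hypothesis mu0 : mu 0 = 1.
Hypothesis mu_gt0 : forall s, 0 < mu s.
Hypothesis mu_rec : forall s, mu s.+2 = s.+2%:R * mu s.
Hypothesis mu_lc : forall s, mu s.+1 ^+ 2 <= mu s * mu s.+2.

Lemma cyclic_moment_cvg s :
  (fun N => cyclic_moment R N s / Num.sqrt N%:R ^+ s) @ \oo --> mu s.
Proof.
rewrite -(cvg_shiftn 1) /=.
(* Dividing the recurrence by the (s + 2)-nd power of sqrt N leaves 1 / sqrt N in front of the
   middle term. The shift by one excludes N = 0 and makes this coefficient at most 1 for every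
   index. *)
pose eps N : R := (Num.sqrt N.+1%:R)^-1.
pose a s N : R := cyclic_moment R N.+1 s / Num.sqrt N.+1%:R ^+ s.
have sq N : 1 <= Num.sqrt N.+1%:R :> R by rewrite -{1}sqrtr1 ler_sqrt // ler1n.
have sq0 N : 0 < Num.sqrt N.+1%:R :> R by rewrite (lt_le_trans _ (sq N)).
rewrite [X in X @ _](_ : _ = a s); last by apply/funext => N; rewrite addn1.
apply: (@wallis_pinning R nat \oo _ eps) => //.
- apply/cvgrPdist_lt => e e0.
  near=> N; rewrite sub0r normrN /eps ger0_norm ?invr_ge0 ?sqrtr_ge0 //.
  rewrite invf_plt ?posrE //.
  rewrite -(ltr_pXn2r (n := 2)) ?nnegrE ?invr_ge0 ?(ltW e0) ?sqrtr_ge0 //.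
  rewrite sqr_sqrtr // -natr1; apply: lt_trans (_ : N%:R < _); last by rewrite ltrDl.
  near: N; exact: nbhs_infty_gtr.
- by move=> N; rewrite /eps invr_ge0 sqrtr_ge0 invf_le1 ?sq0 ?sq.
- by move=> N; rewrite /a cyclic_moment0 // expr0 divr1.
- by move=> k N; rewrite /a divr_ge0 ?exprn_ge0 ?sqrtr_ge0 // ltW // cyclic_moment_gt0.
- move=> k N; rewrite /a /eps cyclic_moment_rec //.
  have {1}-> : N.+1%:R = Num.sqrt N.+1%:R ^+ 2 :> R by rewrite sqr_sqrtr.
  rewrite [_ ^+ k.+2]exprS [_ ^+ k.+1]exprS.
  move: (expf_neq0 k (lt0r_neq0 (sq0 N))) (lt0r_neq0 (sq0 N)) => *; field.
  by apply/andP.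
- move=> k N; rewrite /a mulf_div -exprD expr_div_n -exprM.
  rewrite (_ : (k.+1 * 2 = k + k.+2)%N); last by lia.
  by rewrite ler_pM2r ?cyclic_moment_logconvex // invr_gt0 exprn_gt0.
Unshelve. all: by end_near.
Qed.

Variable j : nat -> nat.
Hypothesis j_bnd : forall n : nat, (0 < n)%N -> (0 < j n <= n)%N.
Hypothesis j_small : (fun n => (j n)%:R / n%:R : R) @ \oo --> (0 : R).

Lemma rest_ratio s : (fun n => (n%:R - s%:R * (j n)%:R) / n%:R : R) @ \oo --> (1 : R).
Proof.
have : (fun n => 1 - s%:R * ((j n)%:R / n%:R) : R) @ \oo --> (1 : R).
  rewrite -[X in _ --> X](subr0 1) -[X in _ --> _ - X](mulr0 s%:R).
  by apply: cvgB; [exact: cvg_cst|apply: cvgM => //; exact: cvg_cst].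
apply: cvg_trans; apply: near_eq_cvg; near=> n.
have n0 : n%:R != 0 :> R by rewrite pnatr_eq0 -lt0n; near: n; exact: nbhs_infty_gt.
by field.
Unshelve. all: by end_near.
Qed.

Lemma rest_large s : \forall n \near \oo, (s * j n < n)%N /\ (n <= (n - s * j n) * 2)%N.
Proof.
have /cvgrPdist_lt/(_ (2^-1) ltac:(by rewrite invr_gt0)) H := rest_ratio s.
near=> n.
have n0 : 0 < n%:R :> R by rewrite ltr0n; near: n; exact: nbhs_infty_gt.
have : `|1 - (n%:R - s%:R * (j n)%:R) / n%:R| < 2^-1 :> R by near: n.
move=> /ltr_normlP[_]; rewrite ltrBlDl addrC -ltrBlDl ltr_pdivlMr // => h.
have : ((s * j n).*2 < n)%N by rewrite -(ltr_nat R) -mul2n !natrM; lra.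
lia.
Unshelve. all: by end_near.
Qed.

Lemma factorial_moment_cvg s :
  (fun n => Emap (R:=R) (fun f : mapping n => ((Xnj (j n) f) ^_ s)%:R) / lambda n (j n) ^+ s)
    @ \oo --> mu s.
Proof.
pose N n := (n - s * j n)%N.
have Ny : N @ \oo --> \oo.
  apply/cvgnyPge => A; near=> n.
  have [] : (s * j n < n)%N /\ (n <= (n - s * j n) * 2)%N by near: n; exact: rest_large.
  have : (A * 2 <= n)%N by near: n; exact: nbhs_infty_ge.
  rewrite /N; lia.
have Nn : (fun n => (N n)%:R / n%:R : R) @ \oo --> (1 : R).
  apply: cvg_trans (rest_ratio s); apply: near_eq_cvg; near=> n.
  have [snj _] : (s * j n < n)%N /\ (n <= (n - s * j n) * 2)%N by near: n; exact: rest_large.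
  by rewrite /N natrB ?natrM // ltnW.
have nN : (fun n => n%:R / (N n)%:R : R) @ \oo --> (1 : R).
  rewrite -[X in _ --> X]invr1; rewrite [X in X @ _](_ : _ = (fun n => ((N n)%:R / n%:R)^-1)).
    by apply: cvgV => //; exact: oner_neq0.
  by apply/funext => n; rewrite invf_div.
have Srat : (fun n => stirling_ratio n / stirling_ratio (N n)) @ \oo --> (1 : R).
  apply: (@squeeze_cvgr _ _ _ _ (cst 1) (fun n => n%:R / (N n)%:R)) => //; last exact: cvg_cst.
  near=> n.
  have [snj _] : (s * j n < n)%N /\ (n <= (n - s * j n) * 2)%N by near: n; exact: rest_large.
  by apply: stirling_ratio_bounds; rewrite ?subn_gt0 ?leq_subr.
have Sq : (fun n => Num.sqrt ((N n)%:R / n%:R : R) ^+ s) @ \oo --> (1 : R).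
  have Sq1 : (fun n => Num.sqrt ((N n)%:R / n%:R : R)) @ \oo --> (1 : R).
    rewrite -[X in _ --> X]sqrtr1.
    exact: (@cvg_comp _ _ _ _ Num.sqrt _ _ _ Nn (@sqrt_continuous R 1)).
  rewrite -[X in _ --> X](expr1n _ s).
  exact: (@cvg_comp _ _ _ _ (fun x : R => x ^+ s) _ _ _ Sq1 (@exprn_continuous R s 1)).
have A : (fun n => cyclic_moment R (N n) s / Num.sqrt (N n)%:R ^+ s) @ \oo --> mu s.
  exact: (cvg_comp N _ Ny (@cyclic_moment_cvg s)).
have H : (fun n => stirling_ratio n / stirling_ratio (N n) *
    (cyclic_moment R (N n) s / Num.sqrt (N n)%:R ^+ s) *
    Num.sqrt ((N n)%:R / n%:R) ^+ s) @ \oo --> mu s.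
  by rewrite -[mu s]mul1r -[X in _ --> X]mulr1; apply: cvgM => //; apply: cvgM.
apply: cvg_trans H; apply: near_eq_cvg; near=> n.
have [snj _] : (s * j n < n)%N /\ (n <= (n - s * j n) * 2)%N by near: n; exact: rest_large.
have n0 : (0 < n)%N by near: n; exact: nbhs_infty_gt.
have /andP[j0 _] := j_bnd n0.
by rewrite Emap_ffact.
Unshelve. all: by end_near.
Qed.

End FactorialMoments.

(** * Mean functionals *)

Section Expectations.
Variable R : realType.
Implicit Types (g h : R -> R) (L : (R -> R) -> R).

(** A class closed under sums and products that contains polynomials, exponentials and indicators of
    half-lines, and on which the Rayleigh integral and the mixed Poisson series converge. *)
Definition tame g := measurable_fun setT g /\
  exists C c : R, forall x, 0 <= x -> `|g x| <= C * expR (c * x).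

Lemma tame_cst (a : R) : tame (fun=> a).
Proof.
split; first exact: measurable_cst.
by exists `|a|, 0 => x _; rewrite mul0r expR0 mulr1.
Qed.

Lemma tame_expR (t : R) : tame (fun x => expR (t * x)).
Proof.
split; first by apply: measurableT_comp => //; exact: measurable_funM.
by exists 1, t => x _; rewrite mul1r ger0_norm // expR_ge0.
Qed.

Lemma tame_id : tame (fun x => x).
Proof.
split; first exact: measurable_id.
exists 1, 1 => x x0; rewrite !mul1r ger0_norm //.
by apply: le_trans (expR_ge1Dx x); rewrite lerDr.
Qed.

Let bound_max (C c c' x : R) : 0 <= x ->
  C * expR (c * x) <= `|C| * expR ((`|c| + `|c'|) * x).
Proof.
move=> x0; apply: le_trans (ler_norm _) _; rewrite normrM [`|expR _|]ger0_norm ?expR_ge0 //.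
rewrite ler_wpM2l // ler_expR ler_wpM2r //.
by apply: le_trans (ler_norm _) _; rewrite lerDl.
Qed.

Lemma tameD g h : tame g -> tame h -> tame (fun x => g x + h x).
Proof.
move=> [mg [C [c gC]]] [mh [D [d hD]]]; split; first exact: measurable_funD.
exists (`|C| + `|D|), (`|c| + `|d|) => x x0; rewrite mulrDl.
apply: le_trans (ler_normD _ _) _; rewrite lerD //.
  exact: le_trans (gC _ x0) (bound_max _ _ _ x0).
by rewrite addrC; exact: le_trans (hD _ x0) (bound_max _ _ _ x0).
Qed.

Lemma tameM g h : tame g -> tame h -> tame (fun x => g x * h x).
Proof.
move=> [mg [C [c gC]]] [mh [D [d hD]]]; split; first exact: measurable_funM.
exists (C * D), (c + d) => x x0; rewrite mulrDl expRD normrM.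
rewrite (_ : C * D * _ = C * expR (c * x) * (D * expR (d * x))); last by ring.
by apply: ler_pM => //; [exact: gC | exact: hD].
Qed.

Lemma tameZ (a : R) g : tame g -> tame (fun x => a * g x).
Proof. by move=> tg; exact: tameM (tame_cst a) tg. Qed.

Lemma tameB g h : tame g -> tame h -> tame (fun x => g x - h x).
Proof.
move=> tg th; have := tameD tg (tameZ (-1) th).
by under eq_fun do rewrite mulN1r.
Qed.

Lemma tameX g n : tame g -> tame (fun x => g x ^+ n).
Proof.
move=> tg; elim: n => [|n IH]; first by under eq_fun do rewrite expr0; exact: tame_cst.
by under eq_fun do rewrite exprS; exact: tameM.
Qed.

Lemma tame_pow n : tame (fun x => x ^+ n).
Proof. exact: tameX tame_id. Qed.

Lemma tame_sum n (f : nat -> R -> R) : (forall k, tame (f k)) ->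
  tame (fun x => \sum_(k < n) f k x).
Proof.
move=> tf; elim: n => [|n IH].
  by under eq_fun do rewrite big_ord0; exact: tame_cst.
by under eq_fun do rewrite big_ord_recr /=; exact: tameD.
Qed.

Lemma tame_le (a : R) : tame (fun x => if x <= a then 1 else 0).
Proof.
split; last first.
  exists 1, 0 => x _; rewrite mul0r expR0 mulr1.
  by case: ifP => _; rewrite ?normr1 ?normr0.
apply: measurable_fun_ifT; [|exact: measurable_cst|exact: measurable_cst].
exact: measurable_fun_ler.
Qed.

(* Positive normalised linear functionals; they are tested on [0, +oo[ only. *)
Definition mean_functional L := [/\
  forall (a : R) g h, tame g -> tame h ->
    L (fun x => a * g x + h x) = a * L g + L h,
  forall g h, tame g -> tame h -> (forall x, 0 <= x -> g x <= h x) -> L g <= L h &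
  L (fun=> 1) = 1].

Section Theory.
Variable L : (R -> R) -> R.
Hypothesis EL : mean_functional L.

Lemma expect_le g h : tame g -> tame h -> (forall x, 0 <= x -> g x <= h x) -> L g <= L h.
Proof. by case: EL => _ H _; exact: H. Qed.

Lemma expect1 : L (fun=> 1) = 1. Proof. by case: EL. Qed.

Lemma expectD g h : tame g -> tame h -> L (fun x => g x + h x) = L g + L h.
Proof.
move=> tg th; case: EL => H _ _; have := H 1 g h tg th.
by under eq_fun do rewrite mul1r; rewrite mul1r.
Qed.

Lemma expect0 : L (fun=> 0) = 0.
Proof.
have := expectD (tame_cst 0) (tame_cst 0); under eq_fun do rewrite addr0.
by move=> e; apply: (@addrI _ (L (fun=> 0))); rewrite addr0 -e.
Qed.

Lemma expectZ (a : R) g : tame g -> L (fun x => a * g x) = a * L g.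
Proof.
move=> tg; case: EL => H _ _; have := H a g _ tg (tame_cst 0).
by under eq_fun do rewrite addr0; rewrite expect0 addr0.
Qed.

Lemma expect_cst (a : R) : L (fun=> a) = a.
Proof.
by have := expectZ a (tame_cst 1); rewrite expect1 mulr1.
Qed.

Lemma expectB g h : tame g -> tame h -> L (fun x => g x - h x) = L g - L h.
Proof.
move=> tg th; have := expectD tg (tameZ (-1) th); rewrite expectZ // mulN1r.
by under eq_fun do rewrite mulN1r.
Qed.

Lemma expect_sum n (f : nat -> R -> R) : (forall k, tame (f k)) ->
  L (fun x => \sum_(k < n) f k x) = \sum_(k < n) L (f k).
Proof.
move=> tf; elim: n => [|n IH].
  by rewrite big_ord0; under eq_fun do rewrite big_ord0; exact: expect0.
rewrite big_ord_recr /= -IH -expectD //; last exact: tame_sum.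
by congr L; apply/funext => x; rewrite big_ord_recr.
Qed.

Lemma expect_ge0 g : tame g -> (forall x, 0 <= x -> 0 <= g x) -> 0 <= L g.
Proof. by move=> tg g0; rewrite -expect0; apply: expect_le => //; exact: tame_cst. Qed.

Lemma expect_dist g h b : tame g -> tame h -> tame b ->
  (forall x, 0 <= x -> `|g x - h x| <= b x) -> `|L g - L h| <= L b.
Proof.
move=> tg th tb H; rewrite -expectB // ler_norml.
rewrite -[- L b]mulN1r -expectZ //; apply/andP; split; apply: expect_le => //.
- exact: tameZ.
- exact: tameB.
- by move=> x x0; rewrite mulN1r lerNl; have := H x x0; rewrite ler_norml => /andP[]; rewrite lerNl.
- exact: tameB.
- by move=> x x0; have := H x x0; rewrite ler_norml => /andP[].
Qed.

End Theory.

(** * Taylor bounds for the exponential and binomial averages *)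

Lemma power_le_expR (n : nat) (y : R) : 0 <= y -> y ^+ n / n`!%:R <= expR y.
Proof.
case: n => [|n] y0; first by rewrite expr0 divr1 -expR0 ler_expR.
by apply: le_trans (expR_ge1Dxn n y0); rewrite lerDr.
Qed.


Lemma is_derive_taylor n (z : R) :
  is_derive z (1 : R) (fun z => \sum_(k < n.+1) (- z) ^+ k / k`!%:R)
    (- \sum_(k < n) (- z) ^+ k / k`!%:R).
Proof.
elim: n => [|n IH].
  rewrite big_ord0 oppr0 (_ : (fun _ => _) = cst 1); first exact: is_derive_cst.
  by apply/funext => y; rewrite big_ord1 expr0 divr1.
rewrite (_ : (fun _ => _) = (fun z => \sum_(k < n.+1) (- z) ^+ k / k`!%:R) +
    (n.+1`!%:R)^-1 \*: ((-%R : R -> R) ^+ n.+1)); last first.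
  by apply/funext => y; rewrite big_ord_recr /= [X in _ + X]mulrC !fctE.
apply: is_derive_eq; rewrite /= [in RHS]big_ord_recr /= opprD; congr (_ + _).
rewrite factS natrM /GRing.scale /=.
have : n.+1%:R != 0 :> R by rewrite pnatr_eq0.
have : n`!%:R != 0 :> R by rewrite pnatr_eq0 -lt0n fact_gt0.
by move: (n.+1%:R : R) (n`!%:R : R) => a b b0 a0; field; rewrite a0 b0.
Qed.

(** Up to the sign (-1)^n, each Taylor remainder is the derivative of the next one, which vanishes
    at 0; starting from exp(-z) > 0, all are nonnegative by the mean value theorem. Two consecutive
    ones add up to z^n / n!, so each is at most that term. *)
Lemma expRN_taylor (K : nat) (y : R) : 0 <= y ->
  `|expR (- y) - \sum_(k < K) (- y) ^+ k / k`!%:R| <= y ^+ K / K`!%:R.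
Proof.
pose f n (z : R) := (-1) ^+ n * (expR (- z) - \sum_(k < n) (- z) ^+ k / k`!%:R).
have f0 n : f n.+1 0 = 0.
  rewrite /f oppr0 expR0 big_ord_recl expr0 divr1 big1 ?addr0 ?subrr ?mulr0 //.
  by move=> k _; rewrite expr0n /= mul0r.
have df n z : is_derive z (1 : R) (f n.+1) (f n z).
  have := is_derive_taylor n z.
  rewrite (_ : f n.+1 = (-1) ^+ n.+1 \*:
     ((expR \o -%R) - (fun z => \sum_(k < n.+1) (- z) ^+ k / k`!%:R))) // => d.
  by apply: is_derive_eq; rewrite /f exprS /GRing.scale /=; ring.
have fS n z : f n z = z ^+ n / n`!%:R - f n.+1 z.
  rewrite /f big_ord_recr /= exprS [(- z) ^+ n]exprNn.
  by have := sqrr_sign R n; rewrite expr2 => e; ring: e.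
have f_ge0 n z : 0 <= z -> 0 <= f n z.
  elim: n z => [|n IH] z z0.
    by rewrite /f expr0 mul1r big_ord0 subr0 expR_ge0.
  have cf : {within `[0, z], continuous (f n.+1)}.
    apply: continuous_subspaceT => x; apply: differentiable_continuous.
    by apply/derivable1_diffP; case: (df n x).
  have [c] := @MVT_segment R (f n.+1) (f n) 0 z z0 (fun x _ => df n x) cf.
  rewrite in_itv /= f0 !subr0 => /andP[c0 _] ->.
  by rewrite mulr_ge0 // IH.
move=> y0; have := f_ge0 K y y0; have := f_ge0 K.+1 y y0; have := fS K y.
have -> : `|expR (- y) - \sum_(k < K) (- y) ^+ k / k`!%:R| = `|f K y|.
  by rewrite /f normrM normrX normrN1 expr1n mul1r.
by move=> e h1 h2; rewrite ger0_norm // e lerBlDr lerDl.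
Qed.

(* [walk m u g] is the mean_functional of [g S] for a binomial variable [S] with [m] trials
   of success probability [u]. *)
Fixpoint walk m (u : R) (g : nat -> R) : R :=
  if m is m'.+1 then u * walk m' u (g \o succn) + (1 - u) * walk m' u g else g 0.

Lemma walk_le m u (g h : nat -> R) : 0 <= u <= 1 -> (forall k, g k <= h k) -> walk m u g <= walk m u h.
Proof.
move=> /andP[u0 u1]; elim: m g h => [|m IH] g h gh //=.
by rewrite lerD // ler_wpM2l ?subr_ge0 // IH // => k; exact: gh.
Qed.

Lemma walk_affine m u (a b : R) (g : nat -> R) : walk m u (fun k => a * g k + b) = a * walk m u g + b.
Proof.
elim: m g => [|m IH] g //=.
by rewrite (IH g) (_ : _ \o succn = fun k => a * (g \o succn) k + b) // IH; ring.
Qed.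

(** The free shift [z] carries the induction: one trial moves the centre by 1 - u or by - u. *)
Lemma walk_var m u z :
  walk m u (fun k => (k%:R - m%:R * u + z) ^+ 2) = m%:R * u * (1 - u) + z ^+ 2.
Proof.
elim: m z => [|m IH] z /=; first by rewrite !mul0r subr0 !add0r.
rewrite (_ : _ \o succn = fun k => (k%:R - m%:R * u + (1 - u + z)) ^+ 2); last first.
  by apply/funext => k /=; rewrite -!natr1; ring.
rewrite (_ : (fun k : nat => (k%:R - m.+1%:R * u + z) ^+ 2) =
    fun k => (k%:R - m%:R * u + (z - u)) ^+ 2); last first.
  by apply/funext => k /=; rewrite -!natr1; ring.
by rewrite !IH -natr1; ring.
Qed.

(** The function is dominated by the squared deviation over (m eta)^2; bounding u (1 - u) by 1 makes
    the estimate uniform in u. *)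
Lemma walk_chebyshev m u (eta : R) (g : nat -> R) : (0 < m)%N -> 0 <= u <= 1 -> 0 < eta ->
  (forall k, g k <= 1) -> (forall k, `|k%:R - m%:R * u| < m%:R * eta -> g k <= 0) ->
  walk m u g <= (m%:R * eta ^+ 2)^-1.
Proof.
move=> m0 u01 eta0 g1 g0; have m0' : 0 < m%:R :> R by rewrite ltr0n.
have me : 0 < m%:R * eta by rewrite mulr_gt0.
apply: le_trans (_ : walk m u (fun k => (m%:R * eta) ^- 2 * (k%:R - m%:R * u + 0) ^+ 2 + 0) <= _).
  apply: walk_le => // k; rewrite !addr0; case: (ltrP `|k%:R - m%:R * u| (m%:R * eta)) => h.
    by apply: le_trans (g0 _ h) _; rewrite mulr_ge0 ?sqr_ge0 // invr_ge0 sqr_ge0.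
  apply: le_trans (g1 k) _; rewrite mulrC ler_pdivlMr ?exprn_gt0 // mul1r.
  by rewrite -[X in _ <= X]real_normK ?num_real // lerXn2r // nnegrE // ltW.
rewrite walk_affine walk_var expr0n /= !addr0.
have -> : (m%:R * eta) ^- 2 * (m%:R * u * (1 - u)) = (m%:R * eta ^+ 2)^-1 * (u * (1 - u)).
  by field; rewrite !gt_eqF.
rewrite ler_piMr ?invr_ge0 ?mulr_ge0 ?sqr_ge0 ?ltW //.
by case/andP: u01 => *; nra.
Qed.

End Expectations.

(** * The method of moments *)

Section MethodOfMoments.
Variable R : realType.

Lemma tame_expRN (t : R) : tame (fun x => expR (- (t * x))).
Proof. by under eq_fun do rewrite -mulNr; exact: tame_expR. Qed.

Lemma expect_taylor (M : (R -> R) -> R) (t : R) K : mean_functional M -> 0 <= t ->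
  `|M (fun x => expR (- (t * x))) -
    \sum_(k < K) ((- t) ^+ k / k`!%:R) * M (fun x => x ^+ k)|
  <= t ^+ K / K`!%:R * M (fun x => x ^+ K).
Proof.
move=> EM t0.
have tc k : tame (fun x : R => (- t) ^+ k / k`!%:R * x ^+ k) by apply: tameZ; exact: tame_pow.
have -> : \sum_(k < K) ((- t) ^+ k / k`!%:R) * M (fun x => x ^+ k) =
    M (fun x => \sum_(k < K) (- t) ^+ k / k`!%:R * x ^+ k).
  rewrite (expect_sum EM _ tc); apply: eq_bigr => k _; rewrite expectZ //.
  exact: tame_pow.
rewrite -expectZ //; last exact: tame_pow.
apply: expect_dist => //; [exact: tame_expRN|exact: (tame_sum _ tc)| |].
  by apply: tameZ; exact: tame_pow.
move=> x x0; have tx : 0 <= t * x by rewrite mulr_ge0.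
have h := expRN_taylor K tx.
have -> : t ^+ K / K`!%:R * x ^+ K = (t * x) ^+ K / K`!%:R by rewrite exprMn mulrAC.
suff -> : \sum_(k < K) (- t) ^+ k / k`!%:R * x ^+ k = \sum_(k < K) (- (t * x)) ^+ k / k`!%:R.
  by [].
by apply: eq_bigr => k _; rewrite -mulNr exprMn mulrAC.
Qed.

(** (t x)^K / K! <= 2^-K exp(2 t x), and the exponential has a finite mean that does not depend on
    K. *)
Lemma moment_small (M : (R -> R) -> R) (t e : R) : mean_functional M -> 0 <= t -> 0 < e ->
  exists K : nat, t ^+ K / K`!%:R * M (fun x => x ^+ K) < e.
Proof.
move=> EM t0 e0; set B := M (fun x => expR (2 * t * x)).
have B0 : 0 <= B by apply: expect_ge0 => //; exact: tame_expR.
(* Because K < 2^K, it is enough to have B / e < K. *)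
pose K := Num.bound (B / e); exists K.
have BK : B / e < K%:R by apply: archi_boundP; rewrite divr_ge0 // ltW.
apply: le_lt_trans (_ : 2 ^- K * B < e).
  rewrite -!expectZ //; [|exact: tame_expR|exact: tame_pow].
  apply: expect_le => // [| |x x0].
  - by apply: tameZ; exact: tame_pow.
  - by apply: tameZ; exact: tame_expR.
  - have h := power_le_expR K (mulr_ge0 (mulr_ge0 (ler0n R 2) t0) x0).
    apply: le_trans (_ : 2 ^- K * ((2 * t * x) ^+ K / K`!%:R) <= _); last first.
      by rewrite ler_wpM2l // invr_ge0 exprn_ge0.
    rewrite le_eqVlt; apply/orP; left; apply/eqP; rewrite !exprMn; field.
    by rewrite expf_neq0 ?pnatr_eq0 // -lt0n fact_gt0.
rewrite mulrC ltr_pdivrMr ?exprn_gt0 //.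
rewrite ltr_pdivrMr // in BK; rewrite mulrC (lt_trans BK) // ltr_pM2r //.
by rewrite -natrX ltr_nat ltn_expl.
Qed.

Variables (T : Type) (F : set_system T).
Hypothesis FF : ProperFilter F.
Variables (Ls : T -> (R -> R) -> R) (L : (R -> R) -> R).
Hypothesis ELs : forall i, mean_functional (Ls i).
Hypothesis EL : mean_functional L.
Hypothesis moments_cvg : forall k : nat,
  (fun i => Ls i (fun x => x ^+ k)) @ F --> L (fun x => x ^+ k).

(** The order K is chosen for the limit alone; the Taylor error of [Ls i] is its own K-th moment
    term, which converges to that of [L]. So no uniform bound along the filter is required. *)
Lemma laplace_cvg (t : R) : 0 <= t ->
  (fun i => Ls i (fun x => expR (- (t * x)))) @ F --> L (fun x => expR (- (t * x))).
Proof.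
move=> t0; apply/cvgrPdist_lt => e e0.
have e4 : 0 < e / 4 by rewrite divr_gt0.
have [K KP] := moment_small EL t0 e4.
have S : (fun i => \sum_(k < K) ((- t) ^+ k / k`!%:R) * Ls i (fun x => x ^+ k)) @ F -->
    \sum_(k < K) ((- t) ^+ k / k`!%:R) * L (fun x => x ^+ k).
  elim: (K) => [|n IH].
    by rewrite big_ord0; under eq_fun do rewrite big_ord0; exact: cvg_cst.
  rewrite big_ord_recr /=; under eq_fun do rewrite big_ord_recr /=.
  by apply: cvgD => //; apply: cvgM; [exact: cvg_cst|exact: moments_cvg].
have B : (fun i => t ^+ K / K`!%:R * Ls i (fun x => x ^+ K)) @ F -->
    t ^+ K / K`!%:R * L (fun x => x ^+ K).
  by apply: cvgM; [exact: cvg_cst|exact: moments_cvg].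
move/cvgrPdist_lt: S => /(_ _ e4) S; move/cvgrPdist_lt: B => /(_ _ e4) B.
near=> i.
have /ltr_normlP[S1 S2] : `|\sum_(k < K) ((- t) ^+ k / k`!%:R) * L (fun x => x ^+ k) -
  \sum_(k < K) ((- t) ^+ k / k`!%:R) * Ls i (fun x => x ^+ k)| < e / 4 by near: i.
have /ltr_normlP[B1 B2] : `|t ^+ K / K`!%:R * L (fun x => x ^+ K) -
  t ^+ K / K`!%:R * Ls i (fun x => x ^+ K)| < e / 4 by near: i.
have /ler_normlP[T1 T2] := expect_taylor K EL t0.
have /ler_normlP[U1 U2] := expect_taylor K (ELs i) t0.
by apply/ltr_normlP; split; lra.
Unshelve. all: by end_near.
Qed.

Let u (x : R) := expR (- x).

Lemma tame_walk m (g : nat -> R) : tame (fun x => walk m (u x) g).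
Proof.
have tu : tame u by have := tame_expRN 1; under eq_fun do rewrite mul1r.
elim: m g => [|m IH] g /=; first exact: tame_cst.
apply: tameD; apply: tameM => //.
by apply: tameB => //; exact: tame_cst.
Qed.

Lemma walk_cvg m (g : nat -> R) :
  (fun i => Ls i (fun x => walk m (u x) g)) @ F --> L (fun x => walk m (u x) g).
Proof.
have tu : tame u by have := tame_expRN 1; under eq_fun do rewrite mul1r.
have tuw k n h : tame (fun x => u x ^+ k * walk n (u x) h).
  by apply: tameM; [exact: tameX | exact: tame_walk].
(* The recursion of [walk] multiplies by powers of exp(-x), hence the extra factor; at m = 0 a
   Laplace transform at the integer k remains. *)
suff H k : (fun i => Ls i (fun x => u x ^+ k * walk m (u x) g)) @ F -->
    L (fun x => u x ^+ k * walk m (u x) g).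
  have e (M : (R -> R) -> R) : M (fun x => walk m (u x) g) = M (fun x => u x ^+ 0 * walk m (u x) g).
    by congr M; apply/funext => x; rewrite expr0 mul1r.
  by rewrite e; under eq_fun do rewrite e; exact: H.
elim: m k g => [|m IH] k g /=.
  have e M : mean_functional M -> M (fun x => u x ^+ k * g 0%N) = g 0%N * M (fun x => expR (- (k%:R * x))).
    move=> EM; rewrite -expectZ //; last exact: tame_expRN.
    by congr M; apply/funext => x; rewrite mulrC /u -expRM_natl mulrN.
  rewrite e //; under eq_fun do rewrite e //.
  by apply: cvgM; [exact: cvg_cst | exact: laplace_cvg].
have e M : mean_functional M ->
    M (fun x => u x ^+ k * (u x * walk m (u x) (g \o succn) + (1 - u x) * walk m (u x) g)) =
    M (fun x => u x ^+ k.+1 * walk m (u x) (g \o succn)) +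
    (M (fun x => u x ^+ k * walk m (u x) g) - M (fun x => u x ^+ k.+1 * walk m (u x) g)).
  move=> EM; rewrite -expectB // -expectD //; last exact: tameB.
  by congr M; apply/funext => x; rewrite exprS; ring.
rewrite e //; under eq_fun do rewrite e //.
by apply: cvgD => //; apply: cvgB.
Qed.

Let ind (a x : R) : R := if x <= a then 1 else 0.

(** A Bernstein polynomial in exp(-x) of a step function whose jump theta lies midway between
    exp(-b) and exp(-a), with eta half the gap. As exp(-x) decreases, x <= a puts the success
    probability above theta + eta and x > b below theta - eta; in between only the bounds 0 and 1
    are used. *)
Let ind_walk (a b : R) : a < b -> forall e, 0 < e ->
  exists m g, forall x, 0 <= x ->
    ind a x <= walk m (u x) g + e /\ walk m (u x) g <= ind b x + e.
Proof.
move=> ab e e0; pose eta := (expR (- a) - expR (- b)) / 2.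
pose theta := (expR (- a) + expR (- b)) / 2.
have eta0 : 0 < eta by rewrite divr_gt0 // subr_gt0 ltr_expR ltrN2.
pose m := (Num.bound (e * eta ^+ 2)^-1).+1.
have m0 : (0 < m)%N by [].
have me : (m%:R * eta ^+ 2)^-1 <= e.
  have ee : 0 < e * eta ^+ 2 by rewrite mulr_gt0 ?exprn_gt0.
  have : (e * eta ^+ 2)^-1 < (Num.bound (e * eta ^+ 2)^-1)%:R.
    by apply: archi_boundP; rewrite invr_ge0 ltW.
  move=> /ltW h; have q0 : 0 < m%:R * eta ^+ 2 by rewrite mulr_gt0 ?exprn_gt0 ?ltr0n.
  rewrite -(ler_pM2l q0) divff ?gt_eqF //.
  have : 1 <= m%:R * (e * eta ^+ 2).
    by rewrite -ler_pdivrMr // div1r; apply: le_trans h _; rewrite ler_nat.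
  by rewrite mulrCA mulrC mulrA.
have m0' : 0 < m%:R :> R by rewrite ltr0n.
pose g (k : nat) : R := if m%:R * theta <= k%:R then 1 else 0.
exists m, g => x x0.
have u01 : 0 <= u x <= 1 by rewrite expR_ge0 expR_le1 oppr_le0.
have w0 : 0 <= walk m (u x) g.
  have : walk m (u x) (fun k => 0 * g k + 0) <= walk m (u x) g.
    by apply: walk_le => // k; rewrite mul0r addr0 /g; case: ifP.
  by rewrite walk_affine mul0r addr0.
have w1 : walk m (u x) g <= 1.
  have : walk m (u x) g <= walk m (u x) (fun k => 0 * g k + 1).
    by apply: walk_le => // k; rewrite mul0r add0r /g; case: ifP.
  by rewrite walk_affine mul0r add0r.
split.
  rewrite /ind; case: ifPn => xa; last by rewrite addr_ge0 // ltW.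
  (* Passing to the complement 1 - g, which vanishes near the mean of the binomial variable when x
     <= a. *)
  rewrite -lerBlDl -[X in X <= _](_ : walk m (u x) (fun k => -1 * g k + 1) = _); last first.
    by rewrite walk_affine; ring.
  apply: le_trans me; apply: walk_chebyshev => // k.
    by rewrite /g; case: ifP => _; lra.
  move=> /ltr_normlP[h _]; rewrite /g ifT; first lra.
  have ux : expR (- a) <= u x by rewrite ler_expR lerN2.
  have : m%:R * (theta + eta) <= m%:R * u x.
    by rewrite ler_pM2l //; move: ux; rewrite /theta /eta; lra.
  by rewrite mulrDr; lra.
rewrite /ind; case: ifPn => xb; first by apply: le_trans w1 _; rewrite lerDl ltW.
rewrite add0r; apply: le_trans me; apply: walk_chebyshev => // k.
  by rewrite /g; case: ifP => _; lra.
move=> /ltr_normlP[_ h]; rewrite /g ifF //; apply/negbTE; rewrite -ltNge.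
have ux : u x <= expR (- b) by rewrite ler_expR lerN2 ltW // ltNge.
have : m%:R * u x <= m%:R * (theta - eta).
  by rewrite ler_pM2l //; move: ux; rewrite /theta /eta; lra.
by rewrite mulrBr; lra.
Qed.

Let cdf_near (a b e : R) : a < b -> 0 < e -> \forall i \near F,
  Ls i (ind a) <= L (ind b) + e /\ L (ind a) - e <= Ls i (ind b).
Proof.
move=> ab e0; have e4 : 0 < e / 4 by rewrite divr_gt0.
have [m [g H]] := ind_walk ab e4.
have tw := tame_walk m g; have tI c : tame (ind c) by exact: tame_le.
have twe : tame (fun x => walk m (u x) g + e / 4) by apply: tameD => //; exact: tame_cst.
have tie c : tame (fun x => ind c x + e / 4) by apply: tameD => //; exact: tame_cst.
have lo M : mean_functional M -> M (ind a) <= M (fun x => walk m (u x) g) + e / 4.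
  move=> EM; rewrite -[X in _ + X](expect_cst EM (e / 4)) -expectD //; last exact: tame_cst.
  by apply: expect_le => // x /H[].
have hi M : mean_functional M -> M (fun x => walk m (u x) g) <= M (ind b) + e / 4.
  move=> EM; rewrite -[X in _ + X](expect_cst EM (e / 4)) -expectD //; last exact: tame_cst.
  by apply: expect_le => // x /H[].
have /cvgrPdist_lt/(_ _ e4) W := @walk_cvg m g.
near=> i.
have /ltr_normlP[W1 W2] : `|L (fun x => walk m (u x) g) - Ls i (fun x => walk m (u x) g)| < e / 4.
  by near: i.
have := lo _ EL; have := hi _ EL; have := lo _ (ELs i); have := hi _ (ELs i).
by move=> *; split; lra.
Unshelve. all: by end_near.
Qed.

Theorem method_of_moments (a : R) :
  {for a, continuous (fun a => L (fun x => if x <= a then 1 else 0))} ->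
  (fun i => Ls i (fun x => if x <= a then 1 else 0)) @ F -->
  L (fun x => if x <= a then 1 else 0).
Proof.
move=> ca; apply/cvgrPdist_lt => e e0; have e4 : 0 < e / 4 by rewrite divr_gt0.
have /cvgrPdist_lt/(_ _ e4)[d /= d0 H] := ca.
have d2 : 0 < d / 2 by rewrite divr_gt0.
(* Half the radius d keeps both comparison points strictly inside the ball given by continuity. *)
have Hp : `|L (ind a) - L (ind (a + d / 2))| < e / 4.
  by apply: (H (a + d / 2)); rewrite /= opprD addrA subrr sub0r normrN gtr0_norm // ltr_pdivrMr //; lra.
have Hm : `|L (ind a) - L (ind (a - d / 2))| < e / 4.
  by apply: (H (a - d / 2)); rewrite /= opprD addrA subrr sub0r opprK gtr0_norm // ltr_pdivrMr //; lra.
have lt1 : a < a + d / 2 by rewrite ltrDl.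
have lt2 : a - d / 2 < a by rewrite ltrBlDr ltrDl.
have N1 := cdf_near lt1 e4; have N2 := cdf_near lt2 e4.
near=> i.
have [+ _] : Ls i (ind a) <= L (ind (a + d / 2)) + e / 4 /\
  L (ind a) - e / 4 <= Ls i (ind (a + d / 2)) by near: i.
have [_] : Ls i (ind (a - d / 2)) <= L (ind a) + e / 4 /\
  L (ind (a - d / 2)) - e / 4 <= Ls i (ind a) by near: i.
move: Hp Hm => /ltr_normlP[p1 p2] /ltr_normlP[q1 q2] m1 m2.
rewrite -/(ind a); apply/ltr_normlP; split; lra.
Unshelve. all: by end_near.
Qed.

End MethodOfMoments.

(** * Rayleigh moments *)

Section Rayleigh.
Variable R : realType.
Local Notation mu := (@lebesgue_measure R).

Lemma ge0_itvE : [set x : R | 0 <= x] = `[0, +oo[%classic.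
Proof. by apply/seteqP; split => x /=; rewrite in_itv /= andbT. Qed.

Lemma continuous_of_derive (F f : R -> R) :
  (forall x, is_derive x (1 : R) F (f x)) -> continuous F.
Proof.
move=> dF x; apply: differentiable_continuous; apply/derivable1_diffP.
by case: (dF x).
Qed.

Lemma integral_antiderivative (f F : R -> R) : (forall x, 0 <= x -> 0 <= f x) ->
  continuous f -> (forall x, is_derive x (1 : R) F (f x)) -> F x @[x --> +oo] --> (0 : R) ->
  (\int[mu]_(x in `[0%R, +oo[) (f x)%:E = (- F 0)%:E)%E.
Proof.
move=> f0 cf dF F0; rewrite (@ge0_continuous_FTC2y _ f F 0 0) //.
- by rewrite sub0e.
- exact: continuous_subspaceT.
- by apply: cvg_at_right_filter; exact: (continuous_of_derive dF).
- by move=> x _; rewrite derive1E; case: (dF x).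
Qed.

Lemma is_derive_gauss (c x : R) :
  is_derive x (1 : R) (fun x => expR (c * x ^+ 2)) (2 * c * x * expR (c * x ^+ 2)).
Proof.
have d : is_derive x (1 : R) (c \*: (@id R ^+ 2)) (2 * c * x).
  by apply: is_derive_eq; rewrite /GRing.scale /=; ring.
have := @is_derive1_comp R expR (c \*: (@id R ^+ 2)) x _ _ (is_derive_expR _) d.
by rewrite mulrC /GRing.scale /=.
Qed.

(** Half of the Gaussian exponent is kept for integrability, the other half absorbs the exponential
    growth of tame functions; [x * gauss4 x] has an elementary antiderivative. *)
Let gauss4 (x : R) := expR (- 4^-1 * x ^+ 2).

Lemma gauss4_cvg (C : R) : C * gauss4 x @[x --> +oo] --> (0 : R).
Proof.
rewrite -[X in _ --> X](mulr0 C); apply: cvgM; first exact: cvg_cst.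
apply: (@squeeze_cvgr _ _ _ _ (cst 0) (fun x => expR (- x))); last first.
- exact: cvgr_expR.
- exact: cvg_cst.
near=> x; rewrite /cst /gauss4 expR_ge0 ler_expR mulNr lerN2 expr2 mulrA.
have x4 : 4 <= x by near: x; exact: nbhs_pinfty_ge.
by rewrite ler_peMl //; lra.
Unshelve. all: by end_near.
Qed.

Lemma gauss4_integral (C : R) : 0 <= C ->
  (\int[mu]_(x in `[0%R, +oo[) (C * (x * gauss4 x))%:E = (2 * C)%:E)%E.
Proof.
move=> C0.
have d x : is_derive x (1 : R) (fun x => - 2 * C * gauss4 x) (C * (x * gauss4 x)).
  have dg := is_derive_gauss (- 4^-1) x.
  rewrite (_ : (fun x => _) = (- 2 * C) \*: (fun x : R => expR (- 4^-1 * x ^+ 2))) //.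
  by apply: is_derive_eq; rewrite /gauss4 /GRing.scale /=; field.
rewrite (@integral_antiderivative _ (fun x => - 2 * C * gauss4 x)) //.
- by rewrite /gauss4 expr0n /= mulr0 expR0; congr EFin; ring.
- by move=> x x0; rewrite !mulr_ge0 ?expR_ge0.
- move=> x; apply: cvgM; first exact: cvg_cst.
  by apply: cvgM => //; apply: (continuous_of_derive (is_derive_gauss (- 4^-1))).
- exact: gauss4_cvg.
Qed.

Lemma gauss4_integrable (C : R) : 0 <= C ->
  mu.-integrable `[0, +oo[ (EFin \o (fun x => C * (x * gauss4 x))).
Proof.
move=> C0; apply/integrableP; split.
  apply/measurable_EFinP; apply: measurable_funTS.
  apply: measurable_funM => //; apply: measurable_funM => //.
  apply: measurableT_comp => //; apply: measurable_funM => //.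
suff -> : (\int[mu]_(x in `[0%R, +oo[) `|(EFin \o (fun x : R => C * (x * gauss4 x))%R) x| =
    \int[mu]_(x in `[0%R, +oo[) (C * (x * gauss4 x))%:E)%E.
  by rewrite gauss4_integral // ltry.
apply: eq_integral => x; rewrite inE /= in_itv /= andbT => x0; congr EFin; rewrite ger0_norm //.
by rewrite !mulr_ge0 ?expR_ge0.
Qed.

Lemma tame_gauss4 (g : R -> R) : tame g -> exists2 C, 0 <= C & forall x, 0 <= x ->
  `|g x| * expR (- (x ^+ 2) / 2) <= C * gauss4 x.
Proof.
move=> [_ [C [c H]]].
have C0 : 0 <= C by have := H 0 (lexx 0); rewrite mulr0 expR0 mulr1; apply: le_trans.
(* From (x / 2 - c)^2 >= 0, c x - x^2 / 2 <= c^2 - x^2 / 4. *)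
exists (C * expR (c ^+ 2)); first by rewrite mulr_ge0 ?expR_ge0.
move=> x x0; apply: le_trans (ler_wpM2r (expR_ge0 _) (H x x0)) _.
rewrite -!mulrA ler_wpM2l // -!expRD ler_expR.
have := sqr_ge0 (2^-1 * x - c); rewrite !expr2; lra.
Qed.

Lemma measurable_rayleigh_density : measurable_fun setT (@rayleigh_density R).
Proof.
apply: measurable_funM => //; apply: measurableT_comp => //.
by apply: measurable_funM => //; apply: measurableT_comp.
Qed.

Lemma rayleigh_integrable (g : R -> R) : tame g ->
  mu.-integrable `[0, +oo[ (EFin \o (fun x => g x * rayleigh_density x)).
Proof.
move=> tg; have [C C0 H] := tame_gauss4 tg.
apply: le_integrable (gauss4_integrable C0) => //.
  apply/measurable_EFinP; apply: measurable_funTS; apply: measurable_funM.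
    by case: tg.
  exact: measurable_rayleigh_density.
move=> x /=; rewrite in_itv /= andbT => x0; rewrite lee_fin.
rewrite [X in _ <= X]ger0_norm ?mulr_ge0 ?expR_ge0 //.
rewrite /rayleigh_density mulrCA normrM [`|x|]ger0_norm // mulrCA ler_wpM2l //.
by rewrite normrM [`|expR _|]ger0_norm ?expR_ge0 // H.
Qed.

(** [integral_antiderivative] wants a nonnegative integrand, but g may change sign. The multiple C x
    exp(-x^2 / 4) that dominates the integrand is added to it, and its known integral is subtracted
    afterwards. *)
Lemma rayleigh_antiderivative (g F : R -> R) : tame g -> continuous g ->
  (forall x, is_derive x (1 : R) F (g x * rayleigh_density x)) ->
  F x @[x --> +oo] --> (0 : R) -> rayleigh_expect g = - F 0.
Proof.
move=> tg cg dF F0; have [C C0 H] := tame_gauss4 tg.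
have ig := rayleigh_integrable tg; have iq := gauss4_integrable C0.
have dg x : is_derive x (1 : R) (fun x => - 2 * C * gauss4 x) (C * (x * gauss4 x)).
  have d4 := is_derive_gauss (- 4^-1) x.
  rewrite (_ : (fun x => _) = (- 2 * C) \*: (fun x : R => expR (- 4^-1 * x ^+ 2))) //.
  by apply: is_derive_eq; rewrite /gauss4 /GRing.scale /=; field.
have cd : continuous (@rayleigh_density R).
  move=> x; apply: cvgM => //.
  have := continuous_of_derive (is_derive_gauss (- 2^-1)).
  rewrite (_ : (fun x => expR (- 2^-1 * x ^+ 2)) = (fun x => expR (- x ^+ 2 / 2))); first exact.
  by apply/funext => y; congr expR; ring.
have c4 : continuous (fun x : R => C * (x * gauss4 x)).
  move=> x; apply: cvgM; first exact: cvg_cst.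
  by apply: cvgM => //; apply: (continuous_of_derive (is_derive_gauss (- 4^-1))).
have S : (\int[mu]_(x in `[0%R, +oo[) (g x * rayleigh_density x + C * (x * gauss4 x))%:E
     = (- (F 0 + - 2 * C * gauss4 0))%:E)%E.
  rewrite (@integral_antiderivative _ (fun x => F x + - 2 * C * gauss4 x)) //.
  - move=> x x0; rewrite (_ : _ + _ = x * (g x * expR (- x ^+ 2 / 2) + C * gauss4 x)); last first.
      by rewrite /rayleigh_density; ring.
    rewrite mulr_ge0 // -lerBlDr sub0r lerNl; apply: le_trans (H x x0); apply: le_trans (ler_norm _) _.
    by rewrite normrN normrM [`|expR _|]ger0_norm // expR_ge0.
  - move=> x; apply: cvgD; last exact: c4.
    by apply: cvgM; [exact: cg | exact: cd].
  - by rewrite -[X in _ --> X]addr0; apply: cvgD => //; exact: gauss4_cvg.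
rewrite /rayleigh_expect ge0_itvE.
have : \int[mu]_(x in `[0, +oo[) (g x * rayleigh_density x + C * (x * gauss4 x)) =
    \int[mu]_(x in `[0, +oo[) (g x * rayleigh_density x) +
    \int[mu]_(x in `[0, +oo[) (C * (x * gauss4 x)) by rewrite RintegralD.
have -> : \int[mu]_(x in `[0, +oo[) (C * (x * gauss4 x)) = 2 * C.
  by rewrite /Rintegral gauss4_integral.
have -> : \int[mu]_(x in `[0, +oo[) (g x * rayleigh_density x + C * (x * gauss4 x)) =
    - (F 0 + - 2 * C * gauss4 0) by rewrite /Rintegral S.
rewrite /gauss4.
by rewrite expr0n /= mulr0 expR0; lra.
Qed.

Lemma rayleigh_mean : mean_functional (@rayleigh_expect R).
Proof.
have mI : measurable `[0 : R, +oo[%classic by exact: measurable_itv.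
split=> [a g h tg th|g h tg th gh|].
- rewrite /rayleigh_expect ge0_itvE -RintegralZl //; last exact: rayleigh_integrable.
  rewrite -RintegralD //.
  + by apply: eq_Rintegral => x _; ring.
  + have := rayleigh_integrable (tameZ a tg).
    by under [X in EFin \o X]eq_fun do rewrite -mulrA.
  + exact: rayleigh_integrable.
- rewrite /rayleigh_expect ge0_itvE; apply: le_Rintegral => //; try exact: rayleigh_integrable.
  move=> x /=; rewrite in_itv /= andbT => x0; rewrite ler_wpM2r ?gh //.
  by rewrite mulr_ge0 ?expR_ge0.
- have d x : is_derive x (1 : R) (fun x => - expR (- 2^-1 * x ^+ 2)) (1 * rayleigh_density x).
    have d := is_derive_gauss (- 2^-1) x.
    rewrite (_ : (fun x => - _) = - (fun x : R => expR (- 2^-1 * x ^+ 2))) //.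
    apply: is_derive_eq; rewrite /rayleigh_density (_ : - x ^+ 2 / 2 = - 2^-1 * x ^+ 2); last by ring.
    by field.
  rewrite (rayleigh_antiderivative _ _ d); last 1 first.
  + rewrite -[X in _ --> X]oppr0; apply: cvgN.
    apply: (@squeeze_cvgr _ _ _ _ (cst 0) (fun x => 1 * gauss4 x)); last first.
    * exact: gauss4_cvg.
    * exact: cvg_cst.
    near=> x; rewrite /cst /gauss4 expR_ge0 mul1r ler_expR; have := sqr_ge0 x; lra.
  + by rewrite expr0n /= mulr0 expR0 opprK.
  + exact: tame_cst.
  + by move=> x; exact: cvg_cst.
Unshelve. all: by end_near.
Qed.

Definition rayleigh_moment k : R := rayleigh_expect (fun x => x ^+ k).

Lemma rayleigh_moment0 : rayleigh_moment 0 = 1.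
Proof.
rewrite /rayleigh_moment; under eq_fun do rewrite expr0.
exact: (expect1 rayleigh_mean).
Qed.

(** Integration by parts, read as the statement that x^(k + 2) exp(-x^2 / 2) vanishes at 0 and at
    infinity. *)
Lemma rayleigh_moment_rec k : rayleigh_moment k.+2 = k.+2%:R * rayleigh_moment k.
Proof.
have tk n : tame (fun x : R => x ^+ n) by exact: tame_pow.
have ck n : continuous (fun x : R => x ^+ n) by move=> x; exact: exprn_continuous.
apply/eqP; rewrite -subr_eq0 -oppr_eq0 opprB /rayleigh_moment.
rewrite -(expectZ rayleigh_mean) // -(expectB rayleigh_mean) //; last exact: tameZ.
have d x : is_derive x (1 : R) (fun x => x ^+ k.+2 * expR (- 2^-1 * x ^+ 2))
    ((k.+2%:R * x ^+ k - x ^+ k.+2) * rayleigh_density x).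
  have d := is_derive_gauss (- 2^-1) x.
  have -> : (fun x : R => x ^+ k.+2 * expR (- 2^-1 * x ^+ 2)) =
    (@id R ^+ k.+2) * (fun x : R => expR (- 2^-1 * x ^+ 2)).
    by apply/funext => y; rewrite !fctE.
  apply: is_derive_eq; rewrite /rayleigh_density (_ : - x ^+ 2 / 2 = - 2^-1 * x ^+ 2); last by ring.
  by rewrite /GRing.scale /= [in LHS]fctE !exprS; field.
rewrite (rayleigh_antiderivative _ _ d); last 1 first.
- have [C C0 H] := tame_gauss4 (tk k.+2).
  apply: (@squeeze_cvgr _ _ _ _ (cst 0) (fun x => C * gauss4 x)); last first.
  + exact: gauss4_cvg.
  + exact: cvg_cst.
  near=> x; have x0 : 0 <= x by near: x; exact: nbhs_pinfty_ge.
  rewrite /cst mulr_ge0 ?expR_ge0 ?exprn_ge0 //.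
  have := H x x0; rewrite ger0_norm ?exprn_ge0 //.
  by rewrite (_ : - x ^+ 2 / 2 = - 2^-1 * x ^+ 2) //; ring.
- by rewrite expr0n /= mul0r oppr0.
- by apply: tameB => //; exact: tameZ.
- move=> x; apply: cvgB; last exact: ck.
  by apply: cvgM; [exact: cvg_cst | exact: ck].
Unshelve. all: by end_near.
Qed.

Lemma rayleigh_moment_ge0 k : 0 <= rayleigh_moment k.
Proof.
apply: (expect_ge0 rayleigh_mean); first exact: tame_pow.
by move=> x x0; rewrite exprn_ge0.
Qed.

(** Mean of the nonnegative function x^k (x - c)^2. *)
Lemma rayleigh_moment_sq k (c : R) :
  0 <= rayleigh_moment k.+2 - 2 * c * rayleigh_moment k.+1 + c ^+ 2 * rayleigh_moment k.
Proof.
have tk n : tame (fun x : R => x ^+ n) by exact: tame_pow.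
rewrite /rayleigh_moment -!(expectZ rayleigh_mean) // -(expectB rayleigh_mean) //; last exact: tameZ.
rewrite -(expectD rayleigh_mean); [|by apply: tameB => //; exact: tameZ|exact: tameZ].
apply: (expect_ge0 rayleigh_mean).
  by apply: tameD; [apply: tameB => //|]; exact: tameZ.
move=> x x0; rewrite (_ : _ + _ = x ^+ k * (x - c) ^+ 2); last by rewrite !exprS; ring.
by rewrite mulr_ge0 ?sqr_ge0 ?exprn_ge0.
Qed.

Lemma rayleigh_moment_gt0 k : 0 < rayleigh_moment k.
Proof.
suff: 0 < rayleigh_moment k /\ 0 < rayleigh_moment k.+1 by case.
elim: k => [|k [IH1 IH2]]; last by split => //; rewrite rayleigh_moment_rec mulr_gt0.
split; first by rewrite rayleigh_moment0.
rewrite lt_def rayleigh_moment_ge0 andbT; apply/eqP => m1.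
(* If the first moment were 0, so would be the third, while the second is 2; the quadratic at c = 2
   would then be -8. *)
have := rayleigh_moment_sq 1 2; rewrite !rayleigh_moment_rec m1 rayleigh_moment0.
by rewrite expr2; lra.
Qed.

Lemma rayleigh_moment_logconvex k :
  rayleigh_moment k.+1 ^+ 2 <= rayleigh_moment k * rayleigh_moment k.+2.
Proof.
have m0 := rayleigh_moment_gt0 k.
have := rayleigh_moment_sq k (rayleigh_moment k.+1 / rayleigh_moment k).
rewrite (_ : _ + _ = rayleigh_moment k.+2 - rayleigh_moment k.+1 ^+ 2 / rayleigh_moment k).
  by rewrite subr_ge0 ler_pdivrMr // mulrC.
by field; rewrite gt_eqF.
Qed.

End Rayleigh.

(** * The Gamma function *)

Section RayleighGamma.
Variable R : realType.
Local Notation mu := (@lebesgue_measure R).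

Lemma integral_halfline_cvg (f : R -> R) (b : nat -> R) :
  measurable_fun setT f -> (forall x, 0 <= x -> 0 <= f x) ->
  {homo b : m n / (m <= n)%N >-> m <= n} -> (forall x, exists n, x <= b n) ->
  (\int[mu]_(x in `[0%R, b n]) (f x)%:E)%E @[n --> \oo] -->
  (\int[mu]_(x in `[0%R, +oo[) (f x)%:E)%E.
Proof.
move=> mf f0 bn bx.
have -> : `[0%R, +oo[%classic = \bigcup_n `[0%R, b n]%classic :> set R.
  apply/seteqP; split => [x /=|x [n _]] /=.
    rewrite in_itv /= andbT => x0; have [n xn] := bx x; exists n => //=.
    by rewrite in_itv /= x0.
  by rewrite !in_itv /= andbT => /andP[].
apply: (@ge0_nondecreasing_set_cvg_integral _ (measurableTypeR R) R
  (fun n => `[0%R, b n]%classic) (EFin \o f) mu) => //.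
- move=> m n mn; rewrite subsetEset => x /=; rewrite !in_itv /= => /andP[-> /=].
  by move=> /le_trans; apply; exact: bn.
- by move=> n; apply/measurable_EFinP; exact: measurable_funTS.
- by move=> n x /=; rewrite in_itv /= lee_fin => /andP[x0 _]; exact: f0.
Qed.

(** Substitution t = x^2 / 2 on the bounded intervals from 0 to n, followed by monotone convergence
    on both sides and uniqueness of the limit. *)
Lemma integral_half_square (G : R -> R) : continuous G -> (forall x, 0 <= x -> 0 <= G x) ->
  (\int[mu]_(x in `[0%R, +oo[) (G x)%:E =
   \int[mu]_(x in `[0%R, +oo[) (G (2^-1 * x ^+ 2) * x)%:E)%E.
Proof.
move=> cG G0; pose F (x : R) := 2^-1 * x ^+ 2.
have dF x : is_derive x (1 : R) F x.
  rewrite (_ : F = 2^-1 \*: (@id R ^+ 2)); last by apply/funext => y; rewrite !fctE.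
  by apply: is_derive_eq; rewrite /GRing.scale /=; field.
have F'E : derive1 F = id by apply/funext => x; rewrite derive1E; case: (dF x).
have cF := continuous_of_derive dF.
have sub n : (\int[mu]_(x in `[0%R, F n%:R]) (G x)%:E =
    \int[mu]_(x in `[0%R, n%:R]) (G (F x) * x)%:E)%E.
  have := @integration_by_substitution_increasing R F G 0 n%:R (ler0n _ n).
  have F0 : F 0 = 0 by rewrite /F expr0n /= mulr0.
  rewrite F'E F0 => -> //.
  - move=> x y; rewrite !in_itv /= => /andP[x0 _] /andP[y0 _] xy.
    by rewrite /F ltr_pM2l ?invr_gt0 // ltrXn2r.
  - by move=> x _; exact: cvg_id.
  - apply/cvg_ex; exists 0; exact: cvg_at_right_filter.
  - apply/cvg_ex; exists n%:R; exact: cvg_at_left_filter.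
  - split.
    + by move=> x _; case: (dF x).
    + by apply: cvg_at_right_filter; exact: cF.
    + by apply: cvg_at_left_filter; exact: cF.
  - exact: continuous_subspaceT.
have cGF : continuous (fun x => G (F x) * x).
  move=> x; apply: cvgM => //; apply: continuous_comp; [exact: cF|exact: cG].
have H1 : (\int[mu]_(x in `[0%R, F n%:R]) (G x)%:E)%E @[n --> \oo] -->
    (\int[mu]_(x in `[0%R, +oo[) (G x)%:E)%E.
  apply: integral_halfline_cvg => //.
  - exact: continuous_measurable_fun.
  - by move=> m n mn; rewrite /F ler_pM2l ?invr_gt0 // lerXn2r ?nnegrE // ler_nat.
  - move=> x; exists (Num.bound `|x|).*2.
    have := archi_boundP (normr_ge0 x); set N := Num.bound _ => xN.
    apply: le_trans (ler_norm x) _; apply: le_trans (ltW xN) _.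
    rewrite /F -mul2n -natrX -(@ler_pM2l _ 2) // mulrA divff // mul1r -natrM ler_nat.
    by rewrite expnMn; nia.
have H2 : (\int[mu]_(x in `[0%R, n%:R]) (G (F x) * x)%:E)%E @[n --> \oo] -->
    (\int[mu]_(x in `[0%R, +oo[) (G (F x) * x)%:E)%E.
  apply: (integral_halfline_cvg (f := fun x => G (F x) * x)).
  - exact: continuous_measurable_fun.
  - by move=> x x0; rewrite mulr_ge0 // G0 // mulr_ge0 ?invr_ge0 ?sqr_ge0.
  - by move=> m n mn; rewrite ler_nat.
  - move=> x; exists (Num.bound `|x|); apply: le_trans (ler_norm x) _.
    by apply/ltW/archi_boundP.
move: H1; under eq_fun do rewrite sub; move=> H1.
exact: (cvg_unique _ H1 H2).
Qed.

Lemma rayleigh_moment_Gamma s : rayleigh_moment R s = 2 `^ (s%:R / 2) * Gamma (s%:R / 2 + 1).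
Proof.
(* t^(s/2) written as a natural power of sqrt t, so that the integrand is continuous on the whole
   line; the two agree for t >= 0. With t = x^2 / 2 it produces x^s over the s-th power of sqrt
   2. *)
pose G (t : R) := Num.sqrt t ^+ s * expR (- t).
have cG : continuous G.
  move=> t; apply: cvgM.
    apply: (@continuous_comp _ _ _ (@Num.sqrt R) (fun x => x ^+ s)).
      exact: sqrt_continuous.
    exact: exprn_continuous.
  by apply: continuous_comp; [exact: cvgN | exact: continuous_expR].
have G0 t : 0 <= t -> 0 <= G t by rewrite mulr_ge0 ?exprn_ge0 ?sqrtr_ge0 ?expR_ge0.
have pw (t : R) : 0 <= t -> t `^ (s%:R / 2) = Num.sqrt t ^+ s.
  by move=> t0; rewrite mulrC powRrM powR12_sqrt // powR_mulrn ?sqrtr_ge0.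
have -> : Gamma (s%:R / 2 + 1) = fine (\int[mu]_(x in `[0%R, +oo[) (G x)%:E)%E.
  rewrite /Gamma addrK /Rintegral.
  have -> : [set t : R | 0 < t] = `]0, +oo[%classic.
    by apply/seteqP; split => x /=; rewrite in_itv /= andbT.
  rewrite -integral_itv_obnd_cbnd; last first.
    by apply/measurable_EFinP/measurable_funTS; exact: continuous_measurable_fun.
  congr fine; apply: eq_integral => x; rewrite inE /= in_itv /= andbT => x0.
  by rewrite pw // ltW.
rewrite integral_half_square // pw //.
set q := Num.sqrt 2; have q0 : 0 < q by rewrite sqrtr_gt0.
have tk : tame (fun x : R => x ^+ s) by exact: tame_pow.
have ik := rayleigh_integrable tk.
rewrite /rayleigh_moment /rayleigh_expect ge0_itvE.
rewrite -[RHS]/(q ^+ s * \int[mu]_(x in `[0, +oo[) (G (2^-1 * x ^+ 2) * x)).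
have -> : \int[mu]_(x in `[0, +oo[) (G (2^-1 * x ^+ 2) * x) =
    \int[mu]_(x in `[0, +oo[) (q ^- s * (x ^+ s * rayleigh_density x)); last first.
  by rewrite RintegralZl // mulrA divff ?mul1r // expf_neq0 // gt_eqF.
apply: eq_Rintegral => x; rewrite inE /= in_itv /= andbT => x0.
rewrite /G /rayleigh_density sqrtrM ?invr_ge0 // sqrtr_sqr ger0_norm // sqrtrV // -/q.
rewrite exprMn exprVn (_ : - (2^-1 * x ^+ 2) = - x ^+ 2 / 2); last by ring.
by ring.
Qed.

End RayleighGamma.

(** * Mixed Poisson moments *)

Section FallingFactorials.
Variable R : realType.

(** Defined on the reals so that mean functionals apply to it. *)
Definition falling i (x : R) : R := \prod_(t < i) (x - t%:R).

Lemma falling_nat i n : falling i n%:R = (n ^_ i)%:R.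
Proof.
elim: i => [|i IH]; first by rewrite /falling big_ord0 ffactn0.
rewrite /falling big_ord_recr /= -/(falling i n%:R) IH ffactnSr natrM.
case: (leqP i n) => ni; first by rewrite natrB.
by rewrite ffact_small // !mul0r.
Qed.

Lemma tame_falling i : tame (falling i).
Proof.
elim: i => [|i IH].
  rewrite (_ : falling 0 = fun=> 1); first exact: tame_cst.
  by apply/funext => x; rewrite /falling big_ord0.
rewrite (_ : falling i.+1 = fun x => falling i x * (x - i%:R)).
  by apply: tameM => //; apply: tameB; [exact: tame_id | exact: tame_cst].
by apply/funext => x; rewrite /falling big_ord_recr.
Qed.

Fixpoint stirling2 k i : nat :=
  match k, i with
  | 0, 0 => 1
  | 0, _ => 0
  | _.+1, 0 => 0
  | k'.+1, i'.+1 => (i'.+1 * stirling2 k' i'.+1 + stirling2 k' i')%N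
  end.

Lemma stirling2_small k i : (k < i)%N -> stirling2 k i = 0%N.
Proof.
elim: k i => [|k IH] [|i] //= ki.
by rewrite !IH ?muln0 // ltnW.
Qed.

Lemma stirling2_diag k : stirling2 k k = 1%N.
Proof. by elim: k => [|k IH] //=; rewrite IH stirling2_small // muln0. Qed.

(** Multiplying by x sends the falling factorial of order i to that of order i + 1 plus i times
    itself, which is the recursion of the Stirling numbers of the second kind. *)
Lemma pow_falling k (x : R) : x ^+ k = \sum_(i < k.+1) (stirling2 k i)%:R * falling i x.
Proof.
elim: k => [|k IH]; first by rewrite big_ord1 /falling big_ord0 mulr1.
rewrite exprS IH [RHS]big_ord_recl /= mul0r add0r.
under [RHS]eq_bigr => i _ do rewrite /bump /= add1n natrD mulrDl.
rewrite big_split /= mulr_sumr.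
have -> : \sum_(i < k.+1) (i.+1 * stirling2 k i.+1)%:R * falling i.+1 x =
    \sum_(i < k.+1) i%:R * ((stirling2 k i)%:R * falling i x).
  rewrite [LHS]big_ord_recr [RHS]big_ord_recl /= stirling2_small // muln0 !mul0r addr0 add0r.
  by apply: eq_bigr => i _; rewrite /bump /= add1n natrM mulrA.
rewrite -big_split /=; apply: eq_bigr => i _.
have -> : falling i.+1 x = falling i x * (x - i%:R) by rewrite /falling big_ord_recr.
ring.
Qed.

Lemma mean_pow (M : (R -> R) -> R) k : mean_functional M ->
  M (fun x => x ^+ k) = \sum_(i < k.+1) (stirling2 k i)%:R * M (falling i).
Proof.
move=> EM; under eq_fun do rewrite pow_falling.
rewrite (expect_sum EM k.+1 (f := fun i x => (stirling2 k i)%:R * falling i x)).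
  by apply: eq_bigr => i _; rewrite expectZ //; exact: tame_falling.
by move=> i; apply: tameZ; exact: tame_falling.
Qed.

End FallingFactorials.

(** * The mixed Poisson law as a Rayleigh mixture *)

Section MixedPoisson.
Variable R : realType.
Local Notation L := (@rayleigh_expect R).
Local Notation mu := (rayleigh_moment R).

Lemma exp_partial_le n (y : R) : 0 <= y -> \sum_(l < n) y ^+ l / l`!%:R <= expR y.
Proof.
move=> y0; have := @nondecreasing_cvgn_le R (series (exp_coeff y)) _ (is_cvg_series_exp_coeff y) n.
rewrite /series /= big_mkord; apply; apply/nondecreasing_seqP => m /=.
by rewrite big_nat_recr //= lerDl divr_ge0 ?exprn_ge0.
Qed.

(** m! l! <= (m + l)!, so the tail from m on is at most y^m / m! times the whole series. *)
Lemma exp_tail_le m (y : R) : 0 <= y ->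
  expR y <= \sum_(l < m) y ^+ l / l`!%:R + y ^+ m / m`!%:R * expR y.
Proof.
move=> y0; apply: limr_le; first exact: is_cvg_series_exp_coeff.
apply: nearW => n; apply: le_trans (_ : series (exp_coeff y) (m + n) <= _).
  rewrite /series /= [in X in _ <= X](@big_cat_nat _ _ _ n) ?leq_addl //= lerDl.
  by apply: sumr_ge0 => l _; rewrite divr_ge0 ?exprn_ge0.
rewrite /series /= (@big_cat_nat _ _ _ m) ?leq_addr //= big_mkord lerD2l.
rewrite -{1}[m]add0n big_addn addKn big_mkord.
apply: le_trans (_ : y ^+ m / m`!%:R * \sum_(l < n) y ^+ l / l`!%:R <= _); last first.
  by rewrite ler_wpM2l ?exp_partial_le // divr_ge0 ?exprn_ge0.
rewrite mulr_sumr; apply: ler_sum => l _.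
rewrite mulf_div -exprD addnC ler_wpM2l ?exprn_ge0 //.
have f0 k : 0 < k`!%:R :> R by rewrite ltr0n fact_gt0.
rewrite lef_pV2 ?posrE ?mulr_gt0 // -natrM ler_nat.
rewrite -(@bin_fact (m + l) m) ?leq_addr // addKn.
by rewrite leq_pmull // bin_gt0 leq_addr.
Qed.

Variable rho : R.
Hypothesis rho0 : 0 < rho.

Let pmf := mpo_pmf rho.

Let term l (x : R) := (rho * x) ^+ l / l`!%:R * expR (- (rho * x)).

Let tame_term l : tame (term l).
Proof.
apply: tameM; last exact: tame_expRN.
have := tameZ (l`!%:R^-1) (tameX l (tameZ rho (@tame_id R))).
by under eq_fun do rewrite mulrC.
Qed.

Lemma mpo_pmfE l : pmf l = L (term l).
Proof.
rewrite /pmf /mpo_pmf -(expectZ (@rayleigh_mean R)).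
  by congr L; apply/funext => x; rewrite /term exprMn; ring.
by apply: tameM; [exact: tame_pow | exact: tame_expRN].
Qed.

Let term_ge0 l x : 0 <= x -> 0 <= term l x.
Proof. by move=> x0; rewrite mulr_ge0 ?expR_ge0 // divr_ge0 // exprn_ge0 // mulr_ge0 // ltW. Qed.

Lemma mpo_pmf_ge0 l : 0 <= pmf l.
Proof. by rewrite mpo_pmfE; apply: (expect_ge0 (@rayleigh_mean R)) => //; exact: term_ge0. Qed.

(** Only finite sums are exchanged with the integral; the limits are controlled afterwards by
    explicit bounds under the Rayleigh mean. *)
Lemma mpo_partial (g : nat -> R) n :
  \sum_(l < n) g l * pmf l = L (fun x => \sum_(l < n) g l * term l x).
Proof.
rewrite (expect_sum (@rayleigh_mean R) n (f := fun l x => g l * term l x)).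
  by apply: eq_bigr => l _; rewrite mpo_pmfE (expectZ (@rayleigh_mean R)).
by move=> l; exact: tameZ.
Qed.

Let tame_partial (g : nat -> R) n : tame (fun x => \sum_(l < n) g l * term l x).
Proof. by apply: (tame_sum n (f := fun l x => g l * term l x)) => l; exact: tameZ. Qed.

Lemma mpo_exp_cvg (c : R) : cvgn (series (fun l => expR (c * l%:R) * pmf l)).
Proof.
apply: nondecreasing_is_cvgn.
  apply/nondecreasing_seqP => n; rewrite /series /= big_nat_recr //= lerDl.
  by rewrite mulr_ge0 ?expR_ge0 ?mpo_pmf_ge0.
(* The Poisson generating function at exp(c), without its factor exp(- rho x) <= 1. *)
exists (L (fun x => expR (expR c * rho * x))) => _ [n _ <-].
rewrite /series /= big_mkord (mpo_partial (fun l => expR (c * l%:R))); apply: (expect_le (@rayleigh_mean R)); first exact: (tame_partial (fun l => expR (c * l%:R))).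
  exact: tame_expR.
move=> x x0; have y0 : 0 <= rho * x by rewrite mulr_ge0 // ltW.
apply: le_trans (_ : \sum_(l < n) (expR c * rho * x) ^+ l / l`!%:R <= _); last first.
  by apply: exp_partial_le; rewrite -mulrA mulr_ge0 ?expR_ge0.
apply: ler_sum => l _; rewrite expRM_natr /term -[expR c * rho * x]mulrA.
rewrite [(expR c * _) ^+ l]exprMn.
rewrite -!mulrA ler_wpM2l ?exprn_ge0 ?expR_ge0 //.
rewrite ler_wpM2l ?exprn_ge0 // ler_piMr ?invr_ge0 // expR_le1; lra.
Qed.

Definition exp_bounded (g : nat -> R) := exists C c, forall l, `|g l| <= C * expR (c * l%:R).

Lemma mpo_cvg (g : nat -> R) : exp_bounded g -> cvgn (series (fun l => g l * pmf l)).
Proof.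
move=> [C [c gC]]; apply: normed_cvg.
apply: (@series_le_cvg _ _ (fun l => C * (expR (c * l%:R) * pmf l))) => //.
- by move=> l /=.
- move=> l; rewrite mulr_ge0 //.
    by have := gC 0%N; rewrite mulr0 expR0 mulr1; apply: le_trans.
  by rewrite mulr_ge0 ?expR_ge0 ?mpo_pmf_ge0.
- move=> l /=; rewrite normrM [`|pmf l|]ger0_norm ?mpo_pmf_ge0 // mulrA.
  by rewrite ler_wpM2r ?mpo_pmf_ge0.
- rewrite (_ : (fun _ => _) = C *: (fun l => expR (c * l%:R) * pmf l)) //.
  by apply: is_cvg_seriesZ; exact: mpo_exp_cvg.
Qed.

Lemma mpo_expect_linear (a : R) g h : exp_bounded g -> exp_bounded h ->
  mpo_expect rho (fun l => a * g l + h l) = a * mpo_expect rho g + mpo_expect rho h.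
Proof.
move=> bg bh; rewrite /mpo_expect -/pmf.
rewrite (_ : (fun l => (a * g l + h l) * pmf l) =
   a *: (fun l => g l * pmf l) + (fun l => h l * pmf l)).
  have cg := mpo_cvg bg; have ch := mpo_cvg bh.
  have ca : cvgn (series (a *: (fun l => g l * pmf l))) by apply: is_cvg_seriesZ.
  by rewrite lim_seriesD // lim_seriesZ.
by apply/funext => l; rewrite !fctE /GRing.scale /=; ring.
Qed.

Lemma mpo_expect_le g h : exp_bounded g -> exp_bounded h -> (forall l, g l <= h l) ->
  mpo_expect rho g <= mpo_expect rho h.
Proof.
move=> bg bh gh; apply: lim_series_le; [exact: mpo_cvg|exact: mpo_cvg|].
by move=> l; rewrite ler_wpM2r ?mpo_pmf_ge0.
Qed.

(** Given x, a Poisson variable of mean y = rho x has factorial moment y^s. Truncation loses at most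
    y^s y^m / m!, which is at most 2^-m y^s exp(2 y), and the Rayleigh mean [B] of the last two
    factors is finite. *)
Lemma mpo_factorial_moment s : mpo_expect rho (fun l => (l ^_ s)%:R) = rho ^+ s * mu s.
Proof.
(* The first s terms of the series vanish; after the shift the remaining m terms form a partial sum
   of the exponential series. *)
apply/cvg_lim => //; rewrite -(cvg_shiftn s) /=.
pose B := L (fun x => (rho * x) ^+ s * expR (2 * rho * x)).
have ts : tame (fun x : R => (rho * x) ^+ s) by apply: tameX; apply: tameZ; exact: tame_id.
have tB : tame (fun x => (rho * x) ^+ s * expR (2 * rho * x)) by apply: tameM => //; exact: tame_expR.
have Bcvg : (fun n => B * (2^-1) ^+ n) @ \oo --> (0 : R).
  rewrite -(mulr0 B); apply: cvgM; first exact: cvg_cst.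
  by apply: cvg_expr; rewrite ger0_norm ?invr_ge0 // invf_lt1 // ltr1n.
have -> : rho ^+ s * mu s = L (fun x => (rho * x) ^+ s).
  rewrite /rayleigh_moment -(expectZ (@rayleigh_mean R)); last exact: tame_pow.
  by congr L; apply/funext => x; rewrite exprMn.
apply/cvgrPdist_le => e e0; move/cvgrPdist_lt: Bcvg => /(_ _ e0) Bcvg; near=> m.
have Be : `|B * 2^-1 ^+ m| < e.
  have : `|0 - B * 2^-1 ^+ m| < e by near: m.
  by rewrite sub0r normrN.
apply: le_trans (ltW Be); apply: le_trans (ler_norm _).
rewrite /series /= big_mkord (mpo_partial (fun l => (l ^_ s)%:R)) mulrC -(expectZ (@rayleigh_mean R)) //.
apply: (expect_dist (@rayleigh_mean R)) => //;
  [exact: (tame_partial (fun l => (l ^_ s)%:R)) | exact: tameZ |].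
move=> x x0; set y := rho * x; have y0 : 0 <= y by rewrite mulr_ge0 // ltW.
have -> : \sum_(l < m + s) (l ^_ s)%:R * term l x =
    y ^+ s * expR (- y) * \sum_(l < m) y ^+ l / l`!%:R.
  rewrite -(big_mkord xpredT (fun l => (l ^_ s)%:R * term l x)) addnC.
  rewrite (@big_cat_nat _ _ _ s) ?leq_addr //= big_nat big1 ?add0r; last first.
    by move=> l /andP[_ ls]; rewrite ffact_small // mul0r.
  rewrite -{1}[s]add0n big_addn addKn big_mkord mulr_sumr; apply: eq_bigr => l _.
  rewrite /term -/y exprD.
  have -> : (l + s)`! = ((l + s) ^_ s * l`!)%N.
    by rewrite -(@ffact_fact (l + s) s) ?leq_addl // addnK.
  rewrite natrM; field.
  by rewrite !pnatr_eq0 -!lt0n ffact_gt0 leq_addl fact_gt0.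
have [P1 P2] := (exp_partial_le m y0, exp_tail_le m y0).
have eN : expR y * expR (- y) = 1 by exact: expRxMexpNx_1.
rewrite (_ : y ^+ s - _ = y ^+ s * (expR (- y) * (expR y - \sum_(l < m) y ^+ l / l`!%:R))); last first.
  by rewrite mulrBr [expR (- y) * expR y]mulrC eN; ring.
rewrite ger0_norm; last first.
  by rewrite mulr_ge0 ?exprn_ge0 // mulr_ge0 ?expR_ge0 // subr_ge0.
rewrite [X in _ <= X]mulrCA ler_wpM2l ?exprn_ge0 //.
apply: le_trans (_ : y ^+ m / m`!%:R <= _).
  apply: le_trans (_ : expR (- y) * (y ^+ m / m`!%:R * expR y) <= _).
    by rewrite ler_wpM2l ?expR_ge0 // lerBlDl.
  by rewrite mulrCA [expR (- y) * _]mulrC eN mulr1.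
have h := power_le_expR m (mulr_ge0 (ler0n R 2) y0).
rewrite (_ : 2 * rho * x = 2 * y); last by rewrite /y mulrA.
apply: le_trans (_ : 2^-1 ^+ m * ((2 * y) ^+ m / m`!%:R) <= _); last first.
  by rewrite ler_wpM2l ?exprn_ge0 ?invr_ge0.
have -> : 2^-1 ^+ m * ((2 * y) ^+ m / m`!%:R) = (2^-1 * 2 * y) ^+ m / m`!%:R.
  by rewrite !exprMn !mulrA.
by rewrite mulVf ?mul1r // pnatr_eq0.
Unshelve. all: by end_near.
Qed.

(** The scale is 1 for the law of Y and rho for that of Y / rho. Normalisation is the factorial
    moment of order 0. *)
Lemma mpo_mean (sigma : R) : 0 < sigma ->
  mean_functional (fun g => mpo_expect rho (fun l => g (l%:R / sigma))).
Proof.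
move=> s0; have bd g : tame g -> exp_bounded (fun l => g (l%:R / sigma)).
  move=> [_ [C [c gC]]]; exists C, (c / sigma) => l.
  by rewrite mulrAC -mulrA gC // divr_ge0 // ltW.
split=> [a g h tg th|g h tg th gh|].
- by apply: mpo_expect_linear; exact: bd.
- by apply: mpo_expect_le => [||l]; [exact: bd|exact: bd|apply: gh; rewrite divr_ge0 // ltW].
- have := mpo_factorial_moment 0; under eq_fun do rewrite ffactn0.
  by rewrite expr0 mul1r rayleigh_moment0.
Qed.

End MixedPoisson.

(** * Assembly *)

Section Limits.
Variable R : realType.

Lemma Emap_mean n j (sigma : R) : 0 <= sigma ->
  mean_functional (fun g => Emap (fun f : mapping n => g ((Xnj j f)%:R / sigma))).
Proof.
move=> s0; split=> [a g h _ _|g h _ _ gh|]; rewrite /Emap.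
- rewrite mulrCA -mulrDr; congr (_ * _).
  by rewrite mulr_sumr -big_split.
- rewrite ler_wpM2l ?invr_ge0 //; apply: ler_sum => f _.
  by apply: gh; rewrite divr_ge0.
- rewrite sumr_const mulVr // unitfE pnatr_eq0 card_ffun card_ord.
  by rewrite -lt0n expn_gt0; case: n.
Qed.

Lemma Emap_mean1 n j :
  mean_functional (fun g => Emap (fun f : mapping n => g (Xnj j f)%:R : R)).
Proof.
have e (g : R -> R) : Emap (fun f : mapping n => g ((Xnj j f)%:R / 1)) =
    Emap (fun f : mapping n => g (Xnj j f)%:R).
  by congr Emap; apply/funext => f; rewrite divr1.
by have := Emap_mean n j (@ler01 R); under eq_fun do rewrite e.
Qed.

Lemma mpo_mean1 (rho : R) : 0 < rho ->
  mean_functional (fun g => mpo_expect rho (fun l => g l%:R)).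
Proof.
move=> r0; have e (g : R -> R) : mpo_expect rho (fun l => g (l%:R / 1)) =
    mpo_expect rho (fun l => g l%:R).
  by congr mpo_expect; apply/funext => f; rewrite divr1.
by have := mpo_mean r0 (@ltr01 R); under eq_fun do rewrite e.
Qed.

Lemma lambda_ge0 n j : 0 <= lambda n j :> R.
Proof.
by rewrite /lambda divr_ge0 ?mulr_ge0 ?exprn_ge0 ?sqrtr_ge0 ?expR_ge0.
Qed.

Lemma Emap_pow n j k :
  Emap (fun f : mapping n => (Xnj j f)%:R ^+ k : R) =
  \sum_(i < k.+1) (stirling2 k i)%:R * Emap (fun f : mapping n => ((Xnj j f) ^_ i)%:R).
Proof.
rewrite (mean_pow k (Emap_mean1 n j)).
by apply: eq_bigr => i _; under eq_fun do rewrite falling_nat.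
Qed.

Lemma mpo_pow (rho : R) k : 0 < rho ->
  mpo_expect rho (fun l => l%:R ^+ k) =
  \sum_(i < k.+1) (stirling2 k i)%:R * (rayleigh_moment R i * rho ^+ i).
Proof.
move=> r0; rewrite (mean_pow k (mpo_mean1 r0)); apply: eq_bigr => i _.
under eq_fun do rewrite falling_nat.
by rewrite mpo_factorial_moment // [rho ^+ i * _]mulrC.
Qed.

Lemma mpo_scaled_pow (rho : R) k : 0 < rho ->
  mpo_expect rho (fun l => (l%:R / rho) ^+ k) = mpo_expect rho (fun l => l%:R ^+ k) / rho ^+ k.
Proof.
move=> r0; rewrite mulrC; have /= <- := expectZ (mpo_mean1 r0) (rho ^- k) (@tame_pow R k).
by congr mpo_expect; apply/funext => l; rewrite expr_div_n mulrC.
Qed.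

(** The term of index i < k carries a positive power of 1 / lam and dies out; the term of index k
    has coefficient 1. This is why all moments of the rescaled variable inherit the limits of the
    factorial moments. *)
Lemma stirling_sum_cvg (T : Type) (F : set_system T) {FF : ProperFilter F}
    (lam : T -> R) (m : nat -> T -> R) (c : nat -> R) k :
  lam @ F --> +oo -> (forall i, m i @ F --> c i) ->
  (fun t => (\sum_(i < k.+1) (stirling2 k i)%:R * (m i t * lam t ^+ i)) / lam t ^+ k) @ F --> c k.
Proof.
move=> ly mc.
have l0 : \forall t \near F, lam t != 0.
  have /cvgryPgt/(_ 0) := ly; apply: filterS => t h; exact: lt0r_neq0.
have lV : (fun t => (lam t)^-1) @ F --> (0 : R).
  apply/cvgrPdist_lt => e e0; near=> t.
  have lt : e^-1 < lam t by near: t; move/cvgryPgt: ly; exact.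
  have lt0 : 0 < lam t by apply: lt_trans lt; rewrite invr_gt0.
  by rewrite sub0r normrN gtr0_norm ?invr_gt0 // invf_plt ?posrE.
have : (fun t => \sum_(i < k) (stirling2 k i)%:R * (m i t * (lam t)^-1 ^+ (k - i)) + m k t) @ F --> c k.
  rewrite -[X in _ --> X]add0r; apply: cvgD; last exact: mc.
  have H n : (n <= k)%N -> (fun t => \sum_(i < n) (stirling2 k i)%:R * (m i t * (lam t)^-1 ^+ (k - i)))
      @ F --> (0 : R).
    elim: n => [_|n IH nk].
      by under eq_fun do rewrite big_ord0; exact: cvg_cst.
    have tl : (fun t => (stirling2 k n)%:R * (m n t * (lam t)^-1 ^+ (k - n))) @ F -->
        (stirling2 k n)%:R * (c n * 0 ^+ (k - n)).
      apply: cvgM; first exact: cvg_cst.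
      apply: cvgM; first exact: mc.
      exact: (@cvg_comp _ _ _ _ (fun x : R => x ^+ (k - n)) _ _ _ lV (@exprn_continuous R (k - n) 0)).
    have H : (fun t => \sum_(i < n) (stirling2 k i)%:R * (m i t * (lam t)^-1 ^+ (k - i)) +
        (stirling2 k n)%:R * (m n t * (lam t)^-1 ^+ (k - n))) @ F --> (0 : R).
      rewrite [X in _ --> X](_ : _ = 0 + (stirling2 k n)%:R * (c n * 0 ^+ (k - n))).
        by apply: cvgD => //; apply: IH; exact: ltnW.
      by rewrite expr0n subn_eq0 leqNgt nk !mulr0 addr0.
    apply: cvg_trans H; apply: near_eq_cvg; apply: nearW => t.
    by rewrite big_ord_recr.
  exact: H.
move=> H; apply: cvg_trans H; apply: near_eq_cvg; near=> t.
have t0 : lam t != 0 by near: t.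
rewrite mulr_suml [in RHS]big_ord_recr /= stirling2_diag mul1r mulfK ?expf_neq0 //.
congr (_ + _); apply: eq_bigr => i _.
rewrite -!mulrA; congr (_ * (_ * _)).
rewrite exprVn; apply: (mulIf (expf_neq0 k t0)); rewrite divfK ?expf_neq0 //.
have -> : lam t ^+ k = lam t ^+ (k - i) * lam t ^+ i.
  by rewrite -exprD subnK // ltnW.
by rewrite mulrA mulVf ?mul1r // expf_neq0.
Unshelve. all: by end_near.
Qed.

End Limits.

Theorem theorem7 (R : realType) :
  (forall j : nat -> nat,
     (forall n : nat, (0 < n)%N -> (0 < j n <= n)%N) ->
     (fun n => (j n)%:R / n%:R : R) @ \oo --> (0 : R) ->
     [/\
       (* factorial moments *)
       (forall s : nat, (0 < s)%N ->
          (fun n => Emap (R:=R) (fun f : mapping n => ((Xnj (j n) f) ^_ s)%:R)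
              / (lambda n (j n) ^+ s * 2 `^ (s%:R / 2) * Gamma (s%:R / 2 + 1)))
            @ \oo --> (1 : R)),
       (* (i) *)
       ((fun n => lambda n (j n) : R) @ \oo --> +oo ->
          cvg_distr
            (fun n x => Emap (R:=R) (fun f : mapping n =>
               if (Xnj (j n) f)%:R / lambda n (j n) <= x then 1 else 0))
            rayleigh_cdf
          /\ forall k : nat,
               (fun n => Emap (R:=R) (fun f : mapping n =>
                  ((Xnj (j n) f)%:R / lambda n (j n)) ^+ k))
                 @ \oo --> rayleigh_expect (fun x => x ^+ k)) &
       (* (ii) *)
       (forall rho : R, 0 < rho ->
          (fun n => lambda n (j n) : R) @ \oo --> rho ->
          cvg_distr
            (fun n x => Emap (R:=R) (fun f : mapping n =>
               if (Xnj (j n) f)%:R <= x then 1 else 0))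
            (fun x => mpo_expect rho (fun l => if l%:R <= x then 1 else 0))
          /\ forall k : nat,
               (fun n => Emap (R:=R) (fun f : mapping n => ((Xnj (j n) f)%:R : R) ^+ k))
                 @ \oo --> mpo_expect rho (fun l => l%:R ^+ k))])
  /\
  (* Y / rho --> X as rho --> +oo, with convergence of all moments *)
  ((forall x : R, {for x, continuous rayleigh_cdf} ->
      (fun rho : R => mpo_expect rho (fun l => if l%:R / rho <= x then 1 else 0))
        @ +oo --> rayleigh_cdf x)
   /\ forall k : nat,
        (fun rho : R => mpo_expect rho (fun l => (l%:R / rho) ^+ k))
          @ +oo --> rayleigh_expect (fun x : R => x ^+ k)).
Proof.
pose mu := rayleigh_moment R.
split.
  move=> j jb j0.
  have fm s : (fun n => Emap (R:=R) (fun f : mapping n => ((Xnj (j n) f) ^_ s)%:R) / lambda n (j n) ^+ s)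
      @ \oo --> mu s.
    apply: factorial_moment_cvg => //.
    - exact: rayleigh_moment0.
    - exact: rayleigh_moment_gt0.
    - exact: rayleigh_moment_rec.
    - exact: rayleigh_moment_logconvex.
  have l0 n : (0 < n)%N -> lambda n (j n) != 0 :> R.
    move=> n0; have /andP[jn _] := jb n n0.
    rewrite gt_eqF // /lambda divr_gt0 ?mulr_gt0 ?exprn_gt0 ?expR_gt0 ?sqrtr_gt0 ?ltr0n //.
    exact: fact_gt0.
  split.
  - move=> s s0; have m0 : mu s != 0 by rewrite gt_eqF // rayleigh_moment_gt0.
    (* The constant in the denominator is the Rayleigh moment [mu s], by its Gamma form. *)
    rewrite [X in _ --> X](_ : 1 = mu s / mu s); last by rewrite divff.
    under eq_fun do rewrite -[lambda _ _ ^+ _ * _ * _]mulrA -rayleigh_moment_Gamma invfM mulrA.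
    by apply: cvgM; [exact: fm | exact: cvg_cst].
  - move=> ly.
    have mom k : (fun n => Emap (R:=R) (fun f : mapping n =>
        ((Xnj (j n) f)%:R / lambda n (j n)) ^+ k)) @ \oo --> mu k.
      have H := stirling_sum_cvg (FF := eventually_filter) (k := k) ly fm.
      apply: cvg_trans H; apply: near_eq_cvg; near=> n.
      have n0 : (0 < n)%N by near: n; exact: nbhs_infty_gt.
      have -> : Emap (R:=R) (fun f : mapping n => ((Xnj (j n) f)%:R / lambda n (j n)) ^+ k) =
          Emap (fun f : mapping n => (Xnj (j n) f)%:R ^+ k) / lambda n (j n) ^+ k.
        rewrite /Emap -mulrA mulr_suml; congr (_ * _).
        by apply: eq_bigr => f _; rewrite expr_div_n.
      rewrite Emap_pow; congr (_ / _); apply: eq_bigr => i _.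
      by rewrite divfK // expf_neq0 // l0.
    split => // x cx.
    exact: (@method_of_moments R nat \oo eventually_filter
      (fun n g => Emap (fun f : mapping n => g ((Xnj (j n) f)%:R / lambda n (j n))))
      (@rayleigh_expect R) (fun n => Emap_mean n (j n) (lambda_ge0 R n (j n)))
      (rayleigh_mean R) mom x cx).
  - move=> rho r0 lr.
    have mom k : (fun n => Emap (R:=R) (fun f : mapping n => ((Xnj (j n) f)%:R : R) ^+ k))
        @ \oo --> mpo_expect rho (fun l => l%:R ^+ k).
      rewrite mpo_pow //.
      have H : (fun n => \sum_(i < k.+1) (stirling2 k i)%:R *
          (Emap (R:=R) (fun f : mapping n => ((Xnj (j n) f) ^_ i)%:R) / lambda n (j n) ^+ i *
           lambda n (j n) ^+ i)) @ \oo -->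
          \sum_(i < k.+1) (stirling2 k i)%:R * (rayleigh_moment R i * rho ^+ i).
        elim: (k.+1) => [|n IH].
          by rewrite big_ord0; under eq_fun do rewrite big_ord0; exact: cvg_cst.
        rewrite big_ord_recr /=; under eq_fun do rewrite big_ord_recr /=.
        apply: cvgD => //; apply: cvgM; first exact: cvg_cst.
        apply: cvgM; first exact: fm.
        exact: (@cvg_comp _ _ _ _ (fun x : R => x ^+ n) _ _ _ lr (@exprn_continuous R n rho)).
      apply: cvg_trans H; apply: near_eq_cvg; near=> n.
      have n0 : (0 < n)%N by near: n; exact: nbhs_infty_gt.
      rewrite Emap_pow; apply: eq_bigr => i _.
      by rewrite divfK // expf_neq0 // l0.
    split => // x cx.
    exact: (@method_of_moments R nat \oo eventually_filter
      (fun n g => Emap (fun f : mapping n => g (Xnj (j n) f)%:R))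
      (fun g => mpo_expect rho (fun l => g l%:R))
      (fun n => Emap_mean1 R n (j n)) (mpo_mean1 r0) mom x cx).
have mom k : (fun rho : R => mpo_expect rho (fun l => (l%:R / rho) ^+ k)) @ +oo --> mu k.
  have H : (fun rho : R => (\sum_(i < k.+1) (stirling2 k i)%:R * (mu i * rho ^+ i)) / rho ^+ k)
      @ +oo --> mu k.
    apply: (stirling_sum_cvg (lam := id) (m := fun i _ => mu i)); first exact: cvg_id.
    by move=> i; exact: cvg_cst.
  apply: cvg_trans H; apply: near_eq_cvg; near=> rho.
  have r0 : 0 < rho by near: rho; exact: nbhs_pinfty_gt.
  by rewrite mpo_scaled_pow // mpo_pow.
split => // x cx.
(* [method_of_moments] takes a mean functional at every index, so nonpositive rho receives the limit
   law as a default value; the filter at +oo does not see it. *)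
pose Ls (rho : R) (g : R -> R) : R :=
  if 0 < rho then mpo_expect rho (fun l => g (l%:R / rho)) else rayleigh_expect g.
have ELs rho : mean_functional (Ls rho).
  case: (boolP (0 < rho)) => r0.
    rewrite (_ : Ls rho = fun g => mpo_expect rho (fun l => g (l%:R / rho))); first exact: mpo_mean.
    by apply/funext => g; rewrite /Ls r0.
  rewrite (_ : Ls rho = @rayleigh_expect R); first exact: rayleigh_mean.
  by apply/funext => g; rewrite /Ls (negPf r0).
have LsE g : \forall rho \near +oo,
    mpo_expect rho (fun l => g (l%:R / rho)) = Ls rho g.
  near=> rho; rewrite /Ls ifT //; near: rho; exact: nbhs_pinfty_gt.
have momL k : (fun rho => Ls rho (fun x => x ^+ k)) @ +oo --> mu k.
  apply: cvg_trans (mom k); apply: near_eq_cvg.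
  exact: LsE (fun x => x ^+ k).
have H := @method_of_moments R R +oo proper_pinfty_nbhs Ls (@rayleigh_expect R)
  ELs (rayleigh_mean R) momL x cx.
apply: cvg_trans H; apply: near_eq_cvg.
have := LsE (fun y => if y <= x then 1 else 0); apply: filterS => rho e.
by rewrite -e.
Unshelve. all: by end_near.
Qed.
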